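(* Let $p$ be a prime number and let $P$ be a finite $p$-group of rank at least $2$. Then there is an exact sequence of abelian groups $$0\longrightarrow \mathcal{R}_{\mathbb{Q}}^*(P)\xrightarrow{\ r_P\ }\varprojlim_{1<Q\le P}\mathcal{R}_{\mathbb{Q}}^*(N_P(Q)/Q)\xrightarrow{\ \tilde d_P\ }\tilde H^0(\mathcal{A}_{\ge 2}(P),p\mathbb{Z})^P\longrightarrow 0,$$ where $r_P$ and $\tilde d_P$ are the maps defined in the context.
   Context: The rank of a $p$-group is the largest rank of an elementary abelian subgroup. Super class functions: for a finite group $G$, $B^*(G)=\mathrm{Hom}_{\mathbb{Z}}(B(G),\mathbb{Z})$, the dual of the Burnside ring, is identified with the group of $\mathbb{Z}$-valued functions on subgroups of $G$ constant on conjugacy classes; the value at $H$ is written $f(G/H)$. Rational class functions: $\mathcal{R}_{\mathbb{Q}}(P)$ is the Grothendieck ring of finitely generated $\mathbb{Q}P$-modules (rational character ring) and $\mathcal{R}_{\mathbb{Q}}^*(P)=\mathrm{Hom}_{\mathbb{Z}}(\mathcal{R}_{\mathbb{Q}}(P),\mathbb{Z})$. The linearization map $B(P)\to\mathcal{R}_{\mathbb{Q}}(P)$, $X\mapsto\mathbb{Q}X$, is surjective (Ritter-Segal), and its transpose identifies $\mathcal{R}_{\mathbb{Q}}^*(P)$ with a subgroup (a biset subfunctor on $p$-groups) of $B^*(P)$. Elements of $\mathcal{R}_{\mathbb{Q}}^*(P)$ are called rational class functions. Gluing data: for $1\ne Q\le P$, destriction (restriction followed by deflation) is $(\mathrm{Des}^P_{N_P(Q)/Q}f)((N_P(Q)/Q)/(L/Q))=f(P/L)$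 for $Q\le L\le N_P(Q)$. $\varprojlim_{1<Q\le P}\mathcal{R}_{\mathbb{Q}}^*(N_P(Q)/Q)$ is the group of sequences $(f_Q)_{1<Q\le P}$, $f_Q\in\mathcal{R}_{\mathbb{Q}}^*(N_P(Q)/Q)$, with (i) ${}^gf_Q=f_{{}^gQ}$ for $g\in P$; (ii) for nontrivial $Q\trianglelefteq R\le P$ and $N_P(Q,R)=N_P(Q)\cap N_P(R)$, $\mathrm{Des}^{N_P(Q)/Q}_{N_P(Q,R)/R}f_Q=\mathrm{Res}^{N_P(R)/R}_{N_P(Q,R)/R}f_R$ (i.e. the value of $f_Q$ at the subgroup $L/Q$ equals the value of $f_R$ at $L/R$ for all $R\le L\le N_P(Q,R)$). The map $r_P$ is $f\mapsto(\mathrm{Des}^P_{N_P(Q)/Q}f)_{1<Q\le P}$. Obstruction group: $\mathcal{A}_{\ge2}(P)$ is the poset of elementary abelian subgroups of $P$ of rank at least $2$, with $P$ acting by conjugation. $\tilde H^0(\mathcal{A}_{\ge2}(P),\mathbb{Z})^P$ is the group of $P$-invariant functions $\phi:\mathcal{A}_{\ge2}(P)\to\mathbb{Z}$ with $\phi(E)=\phi(F)$ whenever $E\le F$, modulo constant functions. $\tilde H^0(\mathcal{A}_{\ge2}(P),p\mathbb{Z})^P$ is its subgroup of classes of such functions with values in $p\mathbb{Z}$. The map $\tilde d_P$: a gluing data $(f_Q)_{1<Q\le P}$ has a solution $f\in B^*(P)$, i.e. $\mathrm{Des}^P_{N_P(Q)/Q}f=f_Q$ for all $1\neq Q\le P$;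 the values $f(P/Q)$ for $Q\ne1$ are determined by the data. $\tilde d_P((f_Q)_{1<Q\le P})$ is the class of the function $\tilde f$ with $\tilde f(E)=\sum_{1<X<E}f(P/X)-p\,f(P/E)$ for $E$ of order $p^2$, and $\tilde f(F)=\tilde f(E)$ for $F$ of order greater than $p^2$, where $E$ is any chosen subgroup of $F$ of order $p^2$. *)

(* Defs.v *)
From HB Require Import structures.
From mathcomp Require Import all_boot all_order all_fingroup all_algebra.
From mathcomp Require Import all_solvable all_field all_character boolp.
From mathcomp Require Import ring_quotient generic_quotient.

Set Implicit Arguments.
Unset Strict Implicit.
Unset Printing Implicit Defensive.

Import GRing.Theory.
Local Open Scope group_scope.
Local Open Scope ring_scope.

Section SuperClassFunctions.

Variables (gT : finGroupType) (G : {group gT}).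

(* An element of B^*(G): [f H] is the value written f(G/H).  As for 'CF(G),   *)
(* the function is extended by 0, here to the H that are not subgroups of G.  *)
Definition is_superclass : {pred {ffun {group gT} -> int}} :=
  fun f => [forall H : {group gT}, (H \subset G) || (f H == 0)]
    && [forall H : {group gT}, forall g in G, f (H :^ g)%G == f H].

Fact is_superclass_zmod_closed : zmod_closed is_superclass.
Proof.
split=> [|f h /andP[/forallP f0 /forallP fJ] /andP[/forallP h0 /forallP hJ]].
  apply/andP; split; first by apply/forallP=> H; rewrite ffunE eqxx orbT.
  by apply/forallP=> H; apply/forall_inP=> g _; rewrite !ffunE.
apply/andP; split; apply/forallP=> H.
  rewrite !ffunE; have [//|nHG] := boolP (H \subset G).
  by have := f0 H; have := h0 H; rewrite (negPf nHG) => /eqP-> /eqP->.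
apply/forall_inP=> g Gg; rewrite !ffunE.
have /forall_inP/(_ g Gg)/eqP-> := fJ H.
by have /forall_inP/(_ g Gg)/eqP-> := hJ H.
Qed.

HB.instance Definition _ :=
  GRing.isZmodClosed.Build _ is_superclass is_superclass_zmod_closed.

Record superclass := SuperClass {
  superclass_val :> {ffun {group gT} -> int};
  superclassP : superclass_val \in is_superclass }.

HB.instance Definition _ := [isSub for superclass_val].
HB.instance Definition _ := [Choice of superclass by <:].
HB.instance Definition _ := [SubChoice_isSubZmodule of superclass by <:].

End SuperClassFunctions.

Section RationalCharacterRing.

Variables (gT : finGroupType) (G : {group gT}).

Definition rat_char (V : representation rat G) : 'CF(G) :=
  cfRepr (map_repr (ratr : rat -> algC) V).

Lemma rat_char_dadd (V W : representation rat G) :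
  rat_char (dadd_grepr V W) = rat_char V + rat_char W.
Proof.
apply/cfun_inP=> x Gx; rewrite !cfunE Gx /= /map_repr_mx.
by rewrite map_block_mx mxtrace_block.
Qed.

Definition is_ratchar : {pred 'CF(G)} := fun chi =>
  `[< exists V W : representation rat G, chi = rat_char V - rat_char W >].

Fact is_ratchar_zmod_closed : zmod_closed is_ratchar.
Proof.
split=> [|_ _ /asboolP[V [W ->]] /asboolP[V' [W' ->]]]; apply/asboolP.
  by exists grepr0, grepr0; rewrite subrr.
exists (dadd_grepr V W'), (dadd_grepr W V').
by rewrite !rat_char_dadd opprB opprD addrACA.
Qed.

HB.instance Definition _ :=
  GRing.isZmodClosed.Build _ is_ratchar is_ratchar_zmod_closed.

(* The Grothendieck group of finitely generated QG-modules, realised as the   *)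
(* rational character ring, i.e. as differences of characters of QG-modules.  *)
Record ratchar := RatChar {
  ratchar_val :> 'CF(G); ratcharP : ratchar_val \in is_ratchar }.

HB.instance Definition _ := [isSub for ratchar_val].
HB.instance Definition _ := [Choice of ratchar by <:].
HB.instance Definition _ := [SubChoice_isSubZmodule of ratchar by <:].

(* Matrix representations act on row vectors, i.e. on the right, so that the  *)
(* transitive G-set G/H appears here as the right cosets of H in G.           *)
Definition coset_mx (H : {group gT}) (x : gT) : 'M[rat]_#|rcosets H G| :=
  \matrix_(i, j) (enum_val i :* x == enum_val j :> {set gT})%g%:R.

Fact coset_mx_repr H : mx_repr G (coset_mx H).
Proof.
split=> [|x y Gx Gy]; apply/matrixP=> i j; rewrite !mxE.
  by rewrite rcoset1 (inj_eq enum_val_inj).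
have Hx : (enum_val i :* x)%g \in rcosets H G.
  have /rcosetsP[a Ga ->] := enum_valP i.
  by rewrite -rcosetM; apply/rcosetsP; exists (a * x)%g; rewrite ?groupM.
rewrite (bigD1 (enum_rank_in Hx (enum_val i :* x)%g)) //= !mxE.
rewrite enum_rankK_in // eqxx mul1r rcosetM big1 ?addr0 // => k nk.
rewrite !mxE; case: eqP => [e|]; last by rewrite mul0r.
by case/eqP: nk; apply: enum_val_inj; rewrite enum_rankK_in.
Qed.

Definition coset_repr H : representation rat G :=
  Representation (MxRepresentation (coset_mx_repr H)).

Fact linearization_subproof H : rat_char (coset_repr H) \in is_ratchar.
Proof.
apply/asboolP; exists (dadd_grepr (coset_repr H) (coset_repr H)).
by exists (coset_repr H); rewrite rat_char_dadd addrK.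
Qed.

(* The class of the permutation module Q[G/H].                                *)
Definition linearization H : ratchar := RatChar (linearization_subproof H).

(* The image of Hom(R_Q(G), Z) in B^*(G) under the transpose of the           *)
(* linearization map.                                                         *)
Definition is_ratclass : {pred superclass G} := fun f =>
  `[< exists phi : {additive ratchar -> int},
        forall H : {group gT}, H \subset G -> f H = phi (linearization H) >].

Fact is_ratclass_zmod_closed : zmod_closed is_ratclass.
Proof.
split=> [|f h /asboolP[phi fE] /asboolP[psi hE]]; apply/asboolP.
  by exists \0 => H _; rewrite ffunE.
by exists (phi \- psi) => H sHG; rewrite !ffunE fE ?hE.
Qed.

HB.instance Definition _ :=
  GRing.isZmodClosed.Build _ is_ratclass is_ratclass_zmod_closed.

Record ratclass := RatClass {
  ratclass_val :> superclass G; ratclassP : ratclass_val \in is_ratclass }.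

HB.instance Definition _ := [isSub for ratclass_val].
HB.instance Definition _ := [Choice of ratclass by <:].
HB.instance Definition _ := [SubChoice_isSubZmodule of ratclass by <:].

End RationalCharacterRing.

Section GluingData.

Variables (gT : finGroupType) (P : {group gT}).

Record ntsubgroup := NtSubgroup {
  ntsubgroup_val :> {group gT};
  ntsubgroupP : (ntsubgroup_val :!=: 1%g) && (ntsubgroup_val \subset P) }.

HB.instance Definition _ := [isSub for ntsubgroup_val].
HB.instance Definition _ := [Finite of ntsubgroup by <:].

Definition ratclass_family :=
  {dffun forall Q : ntsubgroup, ratclass ('N_P(Q) / Q)%G}.

HB.instance Definition _ := Choice.on ratclass_family.

Let famD (s t : ratclass_family) : ratclass_family := [ffun Q => s Q + t Q].
Let famN (s : ratclass_family) : ratclass_family := [ffun Q => - s Q].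
Let fam0 : ratclass_family := [ffun Q => 0].

Fact famDA : associative famD.
Proof. by move=> s t u; apply/ffunP=> Q; rewrite !ffunE addrA. Qed.
Fact famDC : commutative famD.
Proof. by move=> s t; apply/ffunP=> Q; rewrite !ffunE addrC. Qed.
Fact fam0D : left_id fam0 famD.
Proof. by move=> s; apply/ffunP=> Q; rewrite !ffunE add0r. Qed.
Fact famND : left_inverse fam0 famN famD.
Proof. by move=> s; apply/ffunP=> Q; rewrite !ffunE addNr. Qed.

HB.instance Definition _ :=
  GRing.isZmodule.Build ratclass_family famDA famDC fam0D famND.

Lemma fam0E Q : (0 : ratclass_family) Q = 0.
Proof. exact: ffunE. Qed.

Lemma famBE (s t : ratclass_family) Q : (s - t) Q = s Q - t Q.
Proof. by rewrite [LHS]ffunE; congr (_ + _); exact: ffunE. Qed.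

Definition gluing_conj (s : ratclass_family) : Prop :=
  forall (Q R : ntsubgroup) (g : gT), g \in P -> R :=: Q :^ g ->
  forall L : {group gT}, Q \subset L -> L \subset 'N_P(Q) ->
    s R (L :^ g / R)%G = s Q (L / Q)%G.

Definition gluing_compat (s : ratclass_family) : Prop :=
  forall Q R : ntsubgroup, Q <| R ->
  forall L : {group gT}, R \subset L -> L \subset 'N_P(Q) :&: 'N_P(R) ->
    s Q (L / Q)%G = s R (L / R)%G.

Definition is_gluing : {pred ratclass_family} :=
  fun s => `[< gluing_conj s /\ gluing_compat s >].

Fact is_gluing_zmod_closed : zmod_closed is_gluing.
Proof.
split=> [|s t /asboolP[sJ sC] /asboolP[tJ tC]]; apply/asboolP.
  by split=> [Q R g ? ? L ? ? | Q R ? L ? ?]; rewrite !fam0E /= !ffunE.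
split=> [Q R g Pg eR L sQL sLN | Q R nQR L sRL sLN].
  by rewrite !famBE /= !ffunE (sJ Q R) ?(tJ Q R).
by rewrite !famBE /= !ffunE (sC Q R) ?(tC Q R).
Qed.

HB.instance Definition _ :=
  GRing.isZmodClosed.Build _ is_gluing is_gluing_zmod_closed.

Record gluing := Gluing {
  gluing_val : ratclass_family; gluingP : gluing_val \in is_gluing }.

Definition gluing_fun (s : gluing) (Q : ntsubgroup) : ratclass ('N_P(Q) / Q) :=
  gluing_val s Q.

Coercion gluing_fun : gluing >-> Funclass.

HB.instance Definition _ := [isSub for gluing_val].
HB.instance Definition _ := [Choice of gluing by <:].
HB.instance Definition _ := [SubChoice_isSubZmodule of gluing by <:].

(* [fQ] is the destriction of [f] to N_P(Q)/Q.                                *)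
Definition is_destriction (f : superclass P) (Q : {group gT})
    (fQ : superclass ('N_P(Q) / Q)%G) : Prop :=
  forall L : {group gT}, Q \subset L -> L \subset 'N_P(Q) ->
    fQ (L / Q)%G = f L.

Definition is_solution (s : gluing) (f : superclass P) : Prop :=
  forall Q : ntsubgroup, is_destriction f (s Q).

Definition is_rmap (r : ratclass P -> gluing) : Prop :=
  forall f : ratclass P, is_solution (r f) f.

End GluingData.

Section ObstructionGroup.

Variables (p : nat) (gT : finGroupType) (P : {group gT}).

Record abelem2 := Abelem2 {
  abelem2_val :> {group gT};
  abelem2P : (abelem2_val \in 'E_p(P))%g && (1 < 'r(abelem2_val))%N }.

HB.instance Definition _ := [isSub for abelem2_val].
HB.instance Definition _ := [Finite of abelem2 by <:].

(* P-invariant functions, constant on the connected components of the poset.  *)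
Definition is_locconst : {pred {ffun abelem2 -> int}} := fun phi =>
  [forall E : abelem2, forall F : abelem2,
     ([exists g in P, F == E :^ g :> {set gT}]%g ==> (phi F == phi E))
     && ((E \subset F) ==> (phi E == phi F))].

Fact is_locconst_zmod_closed : zmod_closed is_locconst.
Proof.
split=> [|f h /'forall_forallP fP /'forall_forallP hP];
    apply/'forall_forallP=> E F.
  by rewrite !ffunE eqxx !implybT.
rewrite !ffunE; have /andP[f1 f2] := fP E F; have /andP[h1 h2] := hP E F.
apply/andP; split; apply/implyP=> EF.
  by have /eqP-> := implyP f1 EF; have /eqP-> := implyP h1 EF.
by have /eqP-> := implyP f2 EF; have /eqP-> := implyP h2 EF.
Qed.

HB.instance Definition _ :=
  GRing.isZmodClosed.Build _ is_locconst is_locconst_zmod_closed.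

Record locconst := LocConst {
  locconst_val :> {ffun abelem2 -> int};
  locconstP : locconst_val \in is_locconst }.

HB.instance Definition _ := [isSub for locconst_val].
HB.instance Definition _ := [Choice of locconst by <:].
HB.instance Definition _ := [SubChoice_isSubZmodule of locconst by <:].

Definition is_const : {pred locconst} :=
  fun phi => `[< exists c : int, forall E, phi E = c >].

Fact is_const_zmod_closed : zmod_closed is_const.
Proof.
split=> [|f h /asboolP[c fc] /asboolP[d hd]]; apply/asboolP.
  by exists 0 => E; rewrite ffunE.
by exists (c - d) => E; rewrite !ffunE fc hd.
Qed.

HB.instance Definition _ :=
  GRing.isZmodClosed.Build _ is_const is_const_zmod_closed.

(* \tilde H^0(A_{>=2}(P), Z)^P *)
Definition redH0 := Quotient.quot is_const.

HB.instance Definition _ := GRing.Zmodule.on redH0.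

Definition redH0_class (phi : locconst) : redH0 := (\pi_redH0 phi)%qT.

Definition is_redH0p : {pred redH0} := fun c =>
  `[< exists2 phi : locconst, (forall E, (p %| phi E)%Z) & c = redH0_class phi >].

Fact is_redH0p_zmod_closed : zmod_closed is_redH0p.
Proof.
split=> [|_ _ /asboolP[f fp ->] /asboolP[h hp ->]]; apply/asboolP.
  by exists 0 => [E|]; rewrite ?ffunE ?dvdz0 // /redH0_class raddf0.
exists (f - h) => [E|]; last by rewrite /redH0_class raddfB.
by rewrite !ffunE rpredB ?fp ?hp.
Qed.

HB.instance Definition _ :=
  GRing.isZmodClosed.Build _ is_redH0p is_redH0p_zmod_closed.

(* \tilde H^0(A_{>=2}(P), pZ)^P *)
Record redH0p := RedH0p {
  redH0p_val :> redH0; redH0pP : redH0p_val \in is_redH0p }.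

HB.instance Definition _ := [isSub for redH0p_val].
HB.instance Definition _ := [Choice of redH0p by <:].
HB.instance Definition _ := [SubChoice_isSubZmodule of redH0p by <:].

(* [phi] is the function \tilde f built from the super class function [f].    *)
Definition is_tilde (f : superclass P) (phi : locconst) : Prop :=
  (forall E : abelem2, #|E| = (p ^ 2)%N ->
     phi E = (\sum_(X : {group gT} | (X :!=: 1%g) && (X \proper E)) f X)
             - p%:Z * f E)
  /\ (forall E F : abelem2, #|E| = (p ^ 2)%N -> (p ^ 2 < #|F|)%N ->
        E \subset F -> phi F = phi E).

(* The values of a solution [f] away from the trivial subgroup, hence also    *)
(* the class of [phi], are determined by [s].                                 *)
Definition is_dmap (d : gluing P -> redH0p) : Prop :=
  forall s : gluing P, exists (f : superclass P) (phi : locconst),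
    [/\ is_solution s f, is_tilde f phi & d s = redH0_class phi :> redH0].

End ObstructionGroup.

(* Main.v *)
Require Import Defs.
From HB Require Import structures.
From mathcomp Require Import all_boot all_order all_fingroup all_algebra.
From mathcomp Require Import all_solvable all_field all_character.
From mathcomp Require Import boolp ring_quotient generic_quotient.
From mathcomp Require Import zify ring.

Set Implicit Arguments.
Unset Strict Implicit.
Unset Printing Implicit Defensive.

(** The proof rests on a description of rational class functions by linear relations: a
super class function f of a p-group P is rational if and only if, for every section T / S
of P isomorphic to C_p x C_p,
    f(P/S) + p f(P/T) = sum of the f(P/X) over the p + 1 groups S < X < T.

One direction (ratclass_section) transposes a relation between permutation characters,
which says that a plane over F_p is covered by its lines. For the converse
(section_ratclass), a noncyclic p-group has a quotient C_p x C_p, so that the relations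
determine f by its values at cyclic subgroups. These define a class function theta such
that chi |-> <chi, theta> takes the value f(P/H) at the permutation character of P/H. Its
values at rational characters are integers because these characters are integral
combinations of permutation characters; this is the Ritter-Segal theorem (ritter_segal). It
is proved by induction: a normal subgroup C_p x C_p decomposes a representation into pieces
which are induced from proper subgroups or inflated from proper quotients, and without such
a subgroup P is cyclic, dihedral, semidihedral or quaternion, where the part of a rational
character with no fixed vectors under the central subgroup of order p is an explicit
multiple of one character.

Gluing data are then the functions f on nontrivial subgroups that satisfy the relations of
the sections T / S with S nontrivial, and extending f to a rational class function means
choosing f(P/1) such that f(P/1) = tilde f(E) for all elementary abelian E of order p^2.
Hence the kernel of the obstruction map is the image of r_P, and r_P is injective because
such E exist. The function tilde f is constant on components (tilde_const), because it can be
computed symmetrically in a group C_p x C_p x C_p.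

For the remaining claims, divisibility by p and surjectivity, choose a normal subgroup U of
order p^2 and a central subgroup Z of U of order p (pivot_exists), with U elementary abelian
or, in a dihedral or semidihedral group, cyclic of order 4. Every component contains some E
of order p^2 which contains Z. If E does not centralise U, then U permutes the subgroups
X <> Z of order p of E transitively, so that tilde f(E) = f(P/Z) modulo p; if it does, E is
in the component of U. This bounds the image (tilde_mod_p). Conversely, a function phi with
values in pZ, normalised to vanish at U, is the obstruction of the function with value
phi(X Z) / p at subgroups X <> Z of order p and 0 elsewhere: for an E that does not
centralise U, no section T / X isomorphic to C_p x C_p imposes a condition on the value at
X (section_centralising). *)

Import GroupScope GRing.Theory Num.Theory.

(** * Normal subgroups of order p^2 *)

(** In a dihedral, semidihedral or generalised quaternion 2-group P of order
    at least 8, A is a cyclic maximal subgroup and U its subgroup of order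
    4. The last condition says that the elements of P outside A are those
    that invert U. *)
Definition cyclic_cent4 gT (P A U : {group gT}) :=
  [/\ cyclic A /\ A \subset P, #|P : A| = 2%N, U \subset A, #|U| = 4
    & 'C_P(U) = A].

(** If U were centralised by P, the centre of P would have order at least 4,
    whereas it has order 2. The bound on the order excludes the dihedral
    group of order 4, which is abelian. *)
Lemma extremal2_cent gT (P : {group gT}) : extremal2 P -> #|P| > 4 ->
  exists A U : {group gT}, cyclic_cent4 P A U.
Proof.
move=> ext P4.
have [n [x [y [genP cond]]]] : exists n x y, extremal_generators P 2 n (x, y) /\
   ((extremal_class P == SemiDihedral) ==> (#[y] == 2%N)).
  case cP: (extremal_class P) (ext); rewrite /extremal2 cP // => _.
  - case/dihedral_classP: cP => n n1 iso; exists n.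
    by have [[x y] gen _] := generators_2dihedral n1 iso; exists x, y.
  - case/semidihedral_classP: cP => n n1 iso; exists n.
    have [[x y] gen [oy _]] := generators_semidihedral n1 iso; exists x, y.
    by rewrite oy eqxx.
  - case/quaternion_classP: cP => n n1 iso; exists n.
    by have [[x y] gen _] := generators_quaternion n1 iso; exists x, y.
have [_ _ [+ _ _ _] _ _] := extremal2_structure genP ext cond.
have [oP Px ox _] := genP.
have n2 : n > 2 by rewrite -(@ltn_exp2l 2) // -oP.
rewrite n2 => -[_ oZ].
have sXP : <[x]> \subset P by rewrite cycle_subG.
have iX : #|P : <[x]>| = 2%N.
  rewrite -divgS // oP -orderE ox -(subnKC n2) /= expnS mulnK ?expn_gt0 //.
have pX : 2.-group <[x]> by rewrite /pgroup -orderE ox pnatX.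
have [|U [sU _ oU]] := normal_pgroup pX (normal_refl <[x]>) (r := 2).
  by rewrite -orderE ox pfactorK // -ltnS prednK // (ltn_trans _ n2).
exists <[x]>%G, U; split; rewrite ?cycle_cyclic //.
have sXC : <[x]> \subset 'C_P(U).
  by rewrite subsetI sXP centsC (subset_trans sU) //; apply: cycle_abelian.
apply/eqP; rewrite eq_sym eqEproper sXC.
apply/negP=> prX.
have mX : maximal <[x]> P by rewrite p_index_maximal ?iX.
have eC : 'C_P(U) = P.
  apply/eqP; rewrite eqEproper subsetIl; apply/negP=> prC.
  have /= eCX := (maxgroupP mX).2 'C_P(U)%G prC sXC.
  by rewrite eCX properxx in prX.
have: U \subset 'Z(P).
  by rewrite subsetI (subset_trans sU) //= centsC -eC subsetIr.
by move/subset_leq_card; rewrite oU oZ.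
Qed.

(** An abelian noncyclic normal subgroup X of P contributes 'Ohm_1(X), which
    is normal in P and elementary abelian of rank at least 2, hence contains
    a normal subgroup of P of order p^2. If every abelian normal subgroup is
    cyclic, then P is cyclic or a 2-group of maximal class, by the
    classification of p-groups of normal rank one. *)
Lemma pgroup_trichotomy (p : nat) gT (P : {group gT}) : prime p -> p.-group P ->
  [\/ exists2 E : {group gT}, E <| P & E \in 'E_p^2(P),
      cyclic P
    | p = 2%N /\ exists A U : {group gT}, cyclic_cent4 P A U].
Proof.
move=> p_pr pP.
case: (pickP [pred E : {group gT} | (E <| P) && (E \in 'E_p^2(P))]) => [E|noE].
  by case/andP=> nE pE; constructor 1; exists E.
have abcyc (X : {group gT}) : X <| P -> abelian X -> cyclic X.
  move=> nX abX; have sXP := normal_sub nX; have pX := pgroupS sXP pP.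
  rewrite abelian_rank1_cyclic // leqNgt; apply/negP=> rX.
  have nO : 'Ohm_1(X) <| P := gFnormal_trans _ nX.
  have aO : p.-abelem 'Ohm_1(X) by rewrite Ohm1_abelem.
  have [|E [sEO nE oE]] := normal_pgroup pP nO (r := 2).
    by rewrite -(rank_abelem aO) rank_Ohm1.
  have := noE E; rewrite /= nE /= => /negP[].
  apply/pnElemP; split; first exact: normal_sub.
    exact: abelemS aO.
  by rewrite oE pfactorK.
have [|/and3P[/eqP p2 ext cd]] := normal_rank1_structure pP abcyc.
  by constructor 2.
constructor 3; split=> //; apply: extremal2_cent => //.
by case/orP: cd => [|/card_isog->];
  [apply: leq_trans | rewrite (@card_quaternion 3)].
Qed.

Local Open Scope ring_scope.

(** * Fixed points of rational representations *)

Lemma rat_charE (gT : finGroupType) (G : {group gT}) (V : representation rat G) x :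
  x \in G -> rat_char V x = ratr (\tr (V x)).
Proof. by move=> Gx; rewrite cfunE Gx mulr1n /= map_reprE trace_map_mx. Qed.

(** The representation is the space of X-fixed vectors with its action of G
    / X. The average over X is the identity on the fixed vectors and zero on
    the quotient by them, so the trace of g on the fixed vectors is the
    average of the traces of the elements g x. *)
Lemma deflation_repr (gT : finGroupType) (G X : {group gT})
    (V : representation rat G) : X <| G ->
  exists W : representation rat (G / X)%G, forall g, g \in G ->
    rat_char W (coset X g) =
      #|X|%:R^-1 * \sum_(x in X) rat_char V (g * x)%g.
Proof.
move=> nsXG; have [sXG nXG] := andP nsXG; have sXGs := subsetP sXG.
pose modU := normal_rfix_mx_module V nsXG; set U := rfix_mx V X in modU.
pose rU := submod_repr modU; pose rF := factmod_repr modU.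
have rU1 x : x \in X -> rU x = 1%:M.
  move=> Xx.
  have /rfix_mxP/(_ x Xx) := val_submodP (1%:M : 'M_(\rank U)).
  by rewrite /rU /= /submod_mx => ->; rewrite val_submodK.
have krX : X \subset rker rU.
  by apply/subsetP=> x Xx; apply/rkerP; rewrite sXGs ?rU1.
(* The sum over X maps V into its X-fixed vectors, hence is zero modulo
   them. *)
have rF0 : \sum_(x in X) rF x = 0.
  transitivity (in_factmod U (val_factmod (U := U) 1%:M *m \sum_(x in X) V x)).
    rewrite mulmx_sumr raddf_sum /=; apply: eq_bigr => x Xx.
    by rewrite (in_factmodJ modU) ?sXGs // val_factmodK mul1mx.
  apply/eqP; rewrite in_factmod_eq0 mulmx_sub //; apply/rfix_mxP=> y Xy.
  rewrite mulmx_suml [RHS](reindex_inj (mulIg y)) /=; apply: eq_big => x.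
    by rewrite groupMr.
  by move=> Xx; rewrite repr_mxM ?sXGs.
exists (Representation (quo_repr krX nXG)) => g Gg.
have oX : #|X|%:R != 0 :> rat by rewrite pnatr_eq0 -lt0n cardG_gt0.
rewrite rat_charE ?mem_quotient //.
have -> : Representation (quo_repr krX nXG) (coset X g) = rU g.
  exact: quo_repr_coset.
rewrite (eq_bigr (fun x => ratr (\tr (V (g * x)%g)))); last first.
  by move=> x Xx; rewrite rat_charE // groupM // sXGs.
rewrite -rmorph_sum -(ratr_nat _ #|X|) -fmorphV -rmorphM; congr ratr.
apply: (mulfI oX); rewrite mulVKf //.
transitivity (\sum_(x in X) (\tr (rU (g * x)%g) + \tr (rF (g * x)%g))).
  rewrite big_split /= -[X in _ = _ + X]raddf_sum /=.
  have ->: \sum_(x in X) rF (g * x)%g = 0.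
    rewrite (eq_bigr (fun x => rF g *m rF x)).
      by rewrite -mulmx_sumr rF0 mulmx0.
    by move=> x Xx; rewrite repr_mxM // sXGs.
  rewrite mxtrace0 addr0 -sumr_const mulr_suml; apply: eq_bigr => x Xx.
  by rewrite mul1r (repr_mxM rU) ?(rU1 x) ?mulmx1 //; apply: sXGs.
by apply: eq_bigr => x Xx; rewrite mxtrace_sub_fact_mod.
Qed.

(** * Elementary abelian sections of order p^2 *)

Section Sections.

Variables (p : nat) (gT : finGroupType).
Hypothesis p_pr : prime p.
Implicit Types S T X : {group gT}.

(** A group of order p^2 is abelian, so the last condition is what makes T /
    S elementary abelian. *)
Definition psection S T :=
  [/\ S <| T, #|T : S| = (p ^ 2)%N & {in T, forall t, (t ^+ p)%g \in S}].

Lemma psection_subl S T : psection S T -> S \subset T.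
Proof. by case=> /andP[]. Qed.

Lemma psection_card S T : psection S T -> #|T| = (p ^ 2 * #|S|)%N.
Proof. by move=> sec; case: (sec) => _ <- _;
  rewrite mulnC Lagrange ?psection_subl. Qed.

Lemma psection_mid_card S T X : psection S T -> S \proper X -> X \proper T ->
  #|X| = (p * #|S|)%N.
Proof.
move=> sec sSX sXT; have [sS sX] := (proper_sub sSX, proper_sub sXT).
have iS: (#|T : X| * #|X : S|)%N = (p ^ 2)%N.
  by rewrite Lagrange_index //; case: sec.
have iX1: (1 < #|X : S|)%N by rewrite indexg_gt1 proper_subn.
have iT1: (1 < #|T : X|)%N by rewrite indexg_gt1 proper_subn.
have /(dvdn_pfactor _ _ p_pr)[m m2 em] : (#|X : S| %| p ^ 2)%N.
  by rewrite -iS dvdn_mull.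
rewrite -(Lagrange sS) em mulnC.
case: m em m2 => [|[|[|m]]] em // _; first by rewrite em in iX1.
have p2_gt0 : (0 < p ^ 2)%N by rewrite expn_gt0 prime_gt0.
by move: iS iT1; rewrite em -[RHS]mul1n => /eqP; rewrite eqn_pmul2r // => /eqP->.
Qed.

Lemma psection_pgen S T t : psection S T -> t \in T -> t \notin S ->
  #|S <*> <[t]>| = (p * #|S|)%N.
Proof.
move=> [nST iST expT] Tt nSt.
have nt : t \in 'N(S) by apply: (subsetP (normal_norm nST)).
have nSS : S <*> <[t]> \subset 'N(S).
  by rewrite join_subG normG cycle_subG.
rewrite mulnC -(Lagrange (joing_subl S <[t]>)); congr (_ * _)%N.
rewrite -card_quotient // quotientYidl ?cycle_subG // quotient_cycle //.
apply: nt_prime_order => //.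
  by rewrite -morphX //; apply/coset_id/expT.
by apply: contra nSt => /eqP; apply: coset_idr.
Qed.

(** The lines of the plane T / S meet pairwise in the origin: an element of
    T outside S determines the intermediate group that contains it. *)
Lemma psection_pgenP S T t X : psection S T -> t \in T -> t \notin S ->
  (S \proper X) && (X \proper T) && (t \in X) = (X == S <*> <[t]>)%G.
Proof.
move=> sec Tt nSt; have oY := psection_pgen sec Tt nSt.
have p_gt1 := prime_gt1 p_pr; have S_gt0 := cardG_gt0 S.
apply/idP/eqP => [/andP[/andP[sSX sXT] Xt]|->].
  apply/group_inj/esym/eqP; rewrite eqEcard oY (psection_mid_card sec) // leqnn.
  by rewrite join_subG (proper_sub sSX) cycle_subG Xt.
rewrite !properEcard joing_subl join_subG psection_subl // cycle_subG Tt /=.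
rewrite oY (psection_card sec) ltn_Pmull // -mulnn -mulnA ltn_Pmull //=.
  by rewrite -cycle_subG joing_subr.
by rewrite muln_gt0 S_gt0 prime_gt0.
Qed.

Definition between S T := [set X : {group gT} | (S \proper X) && (X \proper T)].

Lemma psection_sum_card (R : zmodType) S T (F : gT -> R) : psection S T ->
  \sum_(X in between S T) \sum_(x in X) F x
    = \sum_(x in T :\: S) F x + (\sum_(x in S) F x) *+ #|between S T|.
Proof.
move=> sec; have sST := psection_subl sec.
rewrite (exchange_big_dep (mem T)) /=; last first.
  by move=> X x /[!inE] /andP[_ /proper_sub/subsetP]; apply.
rewrite (big_setID S) /= (setIidPr sST) addrC; congr (_ + _).
  apply: eq_bigr => x /setDP[Tx nSx].
  rewrite (eq_bigl (pred1 (S <*> <[x]>)%G)) ?big_pred1_eq // => X.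
  by rewrite inE psection_pgenP.
rewrite -sumrMnl; apply: eq_bigr => x Sx; rewrite -sumr_const.
apply: eq_bigl => X; rewrite andb_idr // inE => /andP[/proper_sub/subsetP + _].
exact.
Qed.

(** If there are m intermediate groups, counting elements gives m p |S| =
    (p^2 - 1) |S| + m |S|. *)
Lemma card_between S T : psection S T -> #|between S T| = p.+1.
Proof.
move=> sec; have sST := psection_subl sec.
have := psection_sum_card (fun _ => 1%:Z) sec.
have -> : \sum_(X in between S T) \sum_(x in X) 1%:Z
   = (p * #|S|)%:Z *+ #|between S T|.
  rewrite -sumr_const; apply: eq_bigr => X /[!inE] /andP[sSX sXT].
  by rewrite sumr_const (psection_mid_card sec sSX sXT) natz.
rewrite !sumr_const -[(p * _)%:Z]natz -!mulrnA -mulrnDr => /eqP.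
rewrite eqr_nat cardsD (setIidPr sST) (psection_card sec) => /eqP.
have /prednK <- := prime_gt0 p_pr.
set m := #|between S T|; set q := p.-1; have S_gt0 := cardG_gt0 S => e.
have q_gt0 : (0 < q)%N by rewrite -ltnS prednK ?prime_gt1 ?prime_gt0.
have e1: (q.+1 ^ 2 * #|S| - #|S| = q * #|S| * q.+2)%N.
  by rewrite -{2}[#|S|]mul1n -mulnBl mulnAC; congr (_ * _)%N; lia.
have: (q * #|S| * m == q * #|S| * q.+2)%N.
  by rewrite -(eqn_add2r (#|S| * m)) -e1 -e; apply/eqP; lia.
by rewrite eqn_pmul2l ?muln_gt0 ?q_gt0 // => /eqP.
Qed.

(** The plane T / S is covered by its p + 1 lines; the origin S is counted p
    + 1 times and every other element once. *)
Lemma psection_sum (R : zmodType) S T (F : gT -> R) : psection S T ->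
  \sum_(X in between S T) \sum_(x in X) F x
    = \sum_(x in T) F x + (\sum_(x in S) F x) *+ p.
Proof.
move=> sec; rewrite psection_sum_card // card_between // mulrS addrCA addrA.
by rewrite [in RHS](big_setID (A := T) S) /= (setIidPr (psection_subl sec)).
Qed.

End Sections.

(** * The lattice of permutation characters *)

Lemma orbit_sum (R : zmodType) (aT : finGroupType) (D : {group aT})
    (rT : finType) (to : action D rT) (G : {group aT}) x (F : rT -> R) :
  G \subset D ->
  \sum_(a in G) F (to x a) = (\sum_(y in orbit to G x) F y) *+ #|'C_G[x | to]|.
Proof.
move=> sGD; rewrite (partition_big (to x) (mem (orbit to G x))) /=; last first.
  by move=> a Ga; apply: mem_orbit.
rewrite -sumrMnl; apply: eq_bigr => _ /orbitP[a Ga <-].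
have -> : #|'C_G[x | to]| = #|amove to G x (to x a)|.
  by rewrite amove_act // card_rcoset.
rewrite -sumr_const.
by apply: eq_big => b; [rewrite inE | case/andP=> _ /eqP->].
Qed.

Section PermLattice.

Variable gT : finGroupType.
Implicit Types G H K : {group gT}.

(** Generation as an inductive predicate: an additive property of the
    lattice is then checked on the transitive permutation characters only. *)
Inductive permlat G : 'CF(G) -> Prop :=
| permlat_perm H : H \subset G -> permlat ('Ind[G, H] 1)
| permlatB (a b : 'CF(G)) : permlat a -> permlat b -> permlat (a - b).

Lemma permlat0 G : @permlat G 0.
Proof. by rewrite -(subrr ('Ind[G, G] 1)); apply: permlatB;
  apply: permlat_perm. Qed.

Lemma permlatN G (a : 'CF(G)) : permlat a -> permlat (- a).
Proof. by rewrite -sub0r; apply: permlatB; apply: permlat0. Qed.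

Lemma permlatD G (a b : 'CF(G)) : permlat a -> permlat b -> permlat (a + b).
Proof. by move=> La Lb; rewrite -(opprK b); apply/permlatB/permlatN. Qed.

Lemma permlatMn G (a : 'CF(G)) n : permlat a -> permlat (a *+ n).
Proof.
move=> La; elim: n => [|n IH]; first exact: permlat0.
by rewrite mulrS; apply: permlatD.
Qed.

Lemma permlat_sum G (I : finType) (Q : pred I) (F : I -> 'CF(G)) :
  (forall i, Q i -> permlat (F i)) -> permlat (\sum_(i | Q i) F i).
Proof. by move=> LF; elim/big_rec: _ => [|i a Qi La];
  [apply: permlat0 | apply/permlatD/La/LF]. Qed.

Lemma permlat_Ind G H (a : 'CF(H)) : H \subset G -> permlat a ->
  permlat ('Ind[G] a).
Proof.
move=> sHG; elim=> [K sKH|b c _ Lb _ Lc]; last by rewrite raddfB; apply: permlatB.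
by rewrite cfIndInd //; apply/permlat_perm/(subset_trans sKH).
Qed.

End PermLattice.

(** The inflation of the induced character of K <= G / N is induced from the
    preimage of K. *)
Lemma permlat_Mod (gT : finGroupType) (G N : {group gT}) (a : 'CF(G / N)) :
  N <| G -> permlat a -> permlat (a %% N)%CF.
Proof.
move=> nNG; elim=> [K|b c _ Lb _ Lc]; last by rewrite rmorphB; apply: permlatB.
case/(inv_quotientS nNG)=> H /= defK sNH sHG.
have -> : K = (H / N)%G by apply: val_inj.
have -> : ('Ind[(G / N)%G, (H / N)%G] 1 %% N)%CF = 'Ind[G, H] 1.
  rewrite -(@cfMod_cfun1 _ H N); apply/esym/cfIndMorph => //.
    by rewrite ker_coset.
  exact: normal_norm.
exact: permlat_perm.
Qed.

(** * The Ritter-Segal theorem: reduction by a normal elementary abelian subgroup *)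

(** U / Z has prime order and is normal in the p-group P / Z, so it meets
    the centre of P / Z and is contained in it. *)
Lemma central_chief (p : nat) (gT : finGroupType) (P Z U : {group gT}) :
  p.-group P -> Z \subset 'Z(P) -> Z \subset U -> U <| P -> prime #|U : Z| ->
  [~: U, P] \subset Z.
Proof.
move=> pP sZ sZU nUP; have [sUP nU] := andP nUP.
have [sZP cZP] := subsetIP sZ.
have nZP : P \subset 'N(Z) by apply: cents_norm; rewrite centsC.
have nZU := subset_trans sUP nZP.
rewrite -card_quotient // => pr.
rewrite -quotient_cents2 //.
have nUZ : (U / Z <| P / Z)%g by apply: quotient_normal.
have ntU : (U / Z != 1)%g by rewrite -cardG_gt1 prime_gt1.
have := meet_center_nil (pgroup_nil (quotient_pgroup Z pP)) nUZ ntU.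
rewrite setIC => nt.
have : (U / Z \subset 'Z(P / Z))%g.
  by apply: contraR nt => /(prime_TIg pr)/eqP; rewrite setIC.
by rewrite subsetI => /andP[].
Qed.

(** The induction hypothesis of the Ritter-Segal theorem. It ranges over all
    group types because the induction passes to quotient groups. *)
Definition ritter_segal_below (p n : nat) :=
  forall (gT : finGroupType) (G : {group gT}),
  p.-group G -> (#|G| < n)%N ->
  forall V : representation rat G, permlat (rat_char V).

Lemma res_rat_char (gT : finGroupType) (G H : {group gT}) (V : representation rat
  G) :
  H \subset G -> exists W : representation rat H,
    forall h, h \in H -> rat_char W h = rat_char V h.
Proof.
move=> sHG; exists (Representation (subg_repr V sHG)) => h Hh.
by rewrite !rat_charE // (subsetP sHG).
Qed.

(** The function d is the inflation to H of the character of the X-fixed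
    vectors, a representation of the smaller group H / X. *)
Lemma avg_permlat (p : nat) (gT : finGroupType) (P H X : {group gT})
    (V : representation rat P) : p.-group P -> ritter_segal_below p #|P| ->
  H \subset P -> X <| H -> X :!=: 1%g ->
  exists2 d : 'CF(H), permlat d & forall h, h \in H ->
    d h = #|X|%:R^-1 * \sum_(x in X) rat_char V (h * x)%g.
Proof.
move=> pP IH sHP nXH ntX; have sXH := normal_sub nXH.
have [VH VHE] := res_rat_char V sHP.
have [W WE] := deflation_repr VH nXH.
exists (rat_char W %% X)%CF.
  apply: permlat_Mod => //; apply: IH.
    exact/quotient_pgroup/(pgroupS sHP).
  apply: leq_trans (subset_leq_card sHP).
  by rewrite ltn_quotient.
move=> h Hh; rewrite cfModE // WE //; congr (_ * _); apply: eq_bigr => x Xx.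
by rewrite VHE // groupM // (subsetP sXH).
Qed.

Lemma p2Elem_psection (p : nat) (gT : finGroupType) (P E : {group gT}) :
  E \in 'E_p^2(P) -> psection p 1%G E.
Proof.
move=> pE; have p_pr := pnElem_prime pE; have [sEP abE oE] := pnElemPcard pE.
split; first exact: normal1; first by rewrite indexg1.
move=> t Et; rewrite inE; move/abelemP: (abE) => /(_ p_pr)[_ -> //].
Qed.

(** The group E acts on V through characters whose kernels contain a
    subgroup X of order p, so that V is the sum of the fixed spaces of the p
    + 1 such X, which meet in the fixed space of E. This gives v = sum_X d_X
    - p d_E, where d_X is the character of the fixed space of X. *)
Lemma ritter_segal_central (p : nat) (gT : finGroupType) (P E : {group gT})
    (V : representation rat P) : p.-group P -> ritter_segal_below p #|P| ->
  E \in 'E_p^2(P) -> E \subset 'Z(P) -> permlat (rat_char V).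
Proof.
move=> pP IH pE sEZ; have p_pr := pnElem_prime pE.
have sec := p2Elem_psection pE; have [sEP abE oE] := pnElemPcard pE.
have nX (X : {group gT}) : X \subset E -> X <| P.
  by move=> sXE; apply/sub_center_normal/(subset_trans sXE).
have [dE LdE dEE] := avg_permlat V pP IH (subxx P) (nX E (subxx E)) (nt_pnElem pE
  isT).
have [d dP] : exists d : {group gT} -> 'CF(P), forall X, X \in between 1%G E ->
   permlat (d X) /\ forall h, h \in P ->
   d X h = p%:R^-1 * \sum_(x in X) rat_char V (h * x)%g.
  apply: (@fin_all_exists _ _ (fun X d => X \in between 1%G E ->
    permlat d /\ forall h, h \in P ->
   d h = p%:R^-1 * \sum_(x in X) rat_char V (h * x)%g)) => X.
  have [XB|_] := boolP (X \in _); last by exists 0.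
  move: XB; rewrite inE => /andP[s1X sXE].
  have [|d Ld dE'] := avg_permlat V pP IH (subxx P) (nX X (proper_sub sXE)).
    by rewrite -proper1G.
  exists d; split=> // h Ph; rewrite dE' //.
  by rewrite (psection_mid_card p_pr sec) // cards1 muln1.
have -> : rat_char V = \sum_(X in between 1%G E) d X - dE *+ p.
  apply/cfun_inP=> g Pg; rewrite -scaler_nat [RHS]cfunE sum_cfunE.
  rewrite [X in _ = _ + X]cfunE [X in - X]cfunE dEE //.
  rewrite (eq_bigr (fun X : {group gT} => p%:R^-1 * \sum_(x in X) rat_char V (g *
    x)%g)); last first.
    by move=> X XB; have [_ ->] := dP X XB.
  have p0 : p%:R != 0 :> algC by rewrite pnatr_eq0 -lt0n prime_gt0.
  rewrite -mulr_sumr.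
  rewrite (psection_sum p_pr _ sec).
  rewrite -[1%G : {set gT}]/[set 1%g] big_set1 mulg1.
  rewrite oE natrX.
  set v := rat_char V g; set s := \sum_(x in E) _.
  rewrite -[v *+ p]mulr_natl.
  move: (p%:R : algC) v s p0 => q v s q0; by field.
apply: permlatB; last exact: permlatMn.
by apply: permlat_sum => X XB; have [] := dP X XB.
Qed.

Lemma not_cent_commg (gT : finGroupType) (A : {group gT}) g :
  g \notin 'C(A) -> exists2 u, u \in A & [~ g, u]%g != 1%g.
Proof.
move/centP=> nc; apply/exists_inP; apply/contra_notT: nc => /exists_inPn nc u Au.
by apply/commgP; move: (nc u Au); rewrite negbK.
Qed.

(** Since e commutes with the generator c = [g, e] of Z, the commutator of g
    and e^i is c^i, which runs through Z. *)
Lemma conjg_coset_prime (gT : finGroupType) (Z : {group gT}) (g e z : gT) :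
  prime #|Z| -> e \in 'C(Z) -> [~ g, e]%g \in Z -> [~ g, e]%g != 1%g -> z \in Z ->
  exists i, (g ^ (e ^+ i) = g * z)%g.
Proof.
move=> prZ cZe Zc nc Zz.
have defZ : Z :=: <[[~ g, e]]>.
  apply/esym/eqP; rewrite eqEcard cycle_subG Zc /=.
  by rewrite -(prime_nt_dvdP prZ _ (order_dvdG Zc)) // order_eq1.
have /cycleP[i ->] : z \in <[[~ g, e]]> by rewrite -defZ.
exists i; rewrite conjg_mulR; congr (_ * _)%g; apply: commgX.
by apply: (centP cZe).
Qed.

(** Put Z = E /\ Z(P), of order p. The other p subgroups X of order p of E
    are conjugate, with stabiliser H = 'C_P(E). The part of V without
    Z-fixed vectors is the direct sum over these X of the X-fixed vectors
    modulo the E-fixed ones, so that it is induced from H. In terms of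
    characters, v = d_Z + Ind_H^P (d_X - d_E). Outside H both sides agree
    because g is conjugate there to g z for all z in Z. *)
Lemma ritter_segal_noncentral (p : nat) (gT : finGroupType) (P E : {group gT})
    (V : representation rat P) : p.-group P -> ritter_segal_below p #|P| ->
  E <| P -> E \in 'E_p^2(P) -> ~~ (E \subset 'Z(P)) -> permlat (rat_char V).
Proof.
move=> pP IH nEP pE nsEZ; have p_pr := pnElem_prime pE.
have sec := p2Elem_psection pE; have [sEP abE oE] := pnElemPcard pE.
have cEE := abelem_abelian abE.
pose Z := (E :&: 'Z(P))%G; pose H := 'C_P(E)%G.
have sZE : Z \subset E by apply: subsetIl.
have prZE : Z \proper E.
  by rewrite properE sZE; apply: contra nsEZ => /subset_trans; apply;
    apply: subsetIr.
have ntZ : Z :!=: 1%g by apply: (meet_center_nil (pgroup_nil pP) nEP);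
  apply: (nt_pnElem pE).
have ZB : Z \in between 1%G E by rewrite inE prZE proper1G ntZ.
have oB X : X \in between 1%G E -> #|X| = p.
  rewrite inE => /andP[s1X sXE].
  by rewrite (psection_mid_card p_pr sec) // cards1 muln1.
have oZ := oB _ ZB; have sZZ : Z \subset 'Z(P) by apply: subsetIr.
have [sZP cZP] := subsetIP sZZ.
have nZP : Z <| P by apply: sub_center_normal.
have sHP : H \subset P by apply: subsetIl.
have sEH : E \subset H by rewrite subsetI sEP.
have nHP : H <| P by apply: norm_normalI; apply: norms_cent (normal_norm nEP).
have prHP : H \proper P.
  rewrite properE sHP; apply: contra nsEZ => sPH.
  by rewrite subsetI sEP centsC (subset_trans sPH) ?subsetIr.
have cEP : [~: E, P] \subset Z.
  apply: (central_chief pP sZZ sZE nEP).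
  by rewrite -(divgS sZE) oE oZ expnS expn1 mulnK ?prime_gt0.
have pr_oZ : prime #|Z| by rewrite oZ.
have [X XB neXZ] : exists2 X, X \in between 1%G E & X != Z.
  have: (0 < #|between 1%G E :\ Z|)%N.
    by have := cardsD1 Z (between 1%G E);
      rewrite (card_between p_pr sec) ZB add1n => -[<-]; apply: prime_gt0.
  by case/card_gt0P=> X /setD1P[? ?]; exists X.
have [s1X sXE] : 1%G \proper X /\ X \subset E by move: XB;
  rewrite inE => /andP[-> /proper_sub->].
have tiXZ : X :&: Z = 1%g.
  apply: prime_TIg; rewrite ?(oB _ XB) //; apply: contra neXZ => sXZ.
  by apply/eqP/group_inj/eqP; rewrite eqEcard sXZ oZ (oB _ XB) /=.
(* An element of P that normalises X has its commutators with X in X and in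
   Z, hence centralises E = X Z. *)
have defNX : 'N_P(X) = H.
  apply/eqP; rewrite eqEsubset [X in _ && X]subsetI sHP /=.
  rewrite -[X in _ && X]/(H \subset 'N(X)) [X in _ && X]cents_norm ?andbT;
    last first.
    by rewrite centsC (subset_trans sXE) // centsC subsetIr.
  rewrite subsetI subsetIl /=.
  have cX : 'N_P(X) \subset 'C(X).
    rewrite centsC; apply/commG1P/trivgP;
      rewrite -tiXZ subsetI commg_subl subsetIr /=.
    by rewrite (subset_trans _ cEP) // commgSS // subsetIl.
  have -> : E :=: X <*> Z.
    apply/eqP; rewrite eq_sym eqEproper join_subG sXE sZE /=; apply/negP=> prXZ.
    have XZB : (X <*> Z)%G \in between 1%G E.
      by rewrite inE prXZ (proper_sub_trans s1X) ?joing_subl.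
    have : X :==: X <*> Z by rewrite eqEcard joing_subl /= (oB _ XZB) (oB _ XB) /=.
    move/eqP=> eX; have : Z \subset X by rewrite eX joing_subr.
    by move/setIidPr; rewrite tiXZ => /esym/eqP; rewrite (negPf ntZ).
  rewrite centY subsetI cX /= (subset_trans (subsetIl _ _)) //.
  by rewrite centsC.
have iPH : (1 < #|P : H|)%N by rewrite indexg_gt1 proper_subn.
have ipH : (p <= #|P : H|)%N.
  have /p_natP[k ek] : p.-nat #|P : H|.
    exact: pnat_dvd (dvdn_indexg _ _) pP.
  rewrite ek; case: k ek iPH => [->//|k _ _].
  by rewrite expnS leq_pmulr // expn_gt0 prime_gt0.
have sOrb : orbit 'JG P X \subset between 1%G E :\ Z.
  apply/subsetP=> _ /orbitP[y Py <-] /=.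
  rewrite !inE /=; apply/andP; split.
    apply: contra neXZ => /eqP/(congr1 val)/= eX.
    apply/eqP/group_inj/(@conjsg_inj _ y); rewrite eX.
    by have/normsP->: P \subset 'N(Z) by apply: normal_norm.
  have/normsP/(_ y Py) nE := normal_norm nEP.
  rewrite proper1G -nE properJ; move: XB; rewrite inE proper1G.
  by case/andP=> ntX ->; rewrite -(inj_eq (@conjsg_inj _ y)) conjs1g in ntX *;
    rewrite ntX.
have oOrb : #|orbit 'JG P X| = #|P : H|.
  by rewrite card_orbit astab1JG defNX.
have cB : #|between 1%G E :\ Z| = p.
  by have := cardsD1 Z (between 1%G E);
    rewrite (card_between p_pr sec) ZB add1n => -[<-].
(* The orbit has order |P : H| >= p and lies in a set of p elements. *)
have eOrb : orbit 'JG P X = between 1%G E :\ Z.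
  by apply/eqP; rewrite eqEcard sOrb oOrb cB.
have iP : #|P : H| = p by rewrite -oOrb eOrb.
have oP : #|P| = (p * #|H|)%N by rewrite -(Lagrange sHP) iP mulnC.
have [dZ LdZ dZE] := avg_permlat V pP IH (subxx P) nZP ntZ.
have [dX LdX dXE] : exists2 d : 'CF(H), permlat d & forall h, h \in H ->
    d h = #|X|%:R^-1 * \sum_(x in X) rat_char V (h * x)%g.
  apply: (avg_permlat V pP IH sHP); last by rewrite -proper1G.
  rewrite /normal (subset_trans sXE sEH) cents_norm //.
  by rewrite centsC (subset_trans sXE) // centsC subsetIr.
have [dE LdE dEE] : exists2 d : 'CF(H), permlat d & forall h, h \in H ->
    d h = #|E|%:R^-1 * \sum_(x in E) rat_char V (h * x)%g.
  apply: (avg_permlat V pP IH sHP); last exact: (nt_pnElem pE).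
  exact: normalS nEP.
set v := rat_char V in dZE dXE dEE *.
have -> : v = dZ + 'Ind[P, H] (dX - dE); last first.
  by apply/permlatD/permlat_Ind => //; apply: permlatB.
have vJ g y : y \in P -> v (g ^ y)%g = v g by apply: cfunJ.
clearbody v; apply/cfun_inP=> g Pg.
rewrite [RHS]cfunE cfIndE // dZE // oZ.
have p0 : p%:R != 0 :> algC by rewrite pnatr_eq0 -lt0n prime_gt0.
have [Hg|nHg] := boolP (g \in H); last first.
  rewrite [X in _ = _ + _ * X]big1 ?mulr0 ?addr0; last first.
    move=> y Py; apply: cfun0; rewrite memJ_norm //.
    exact: (subsetP (normal_norm nHP)).
  rewrite (eq_bigr (fun=> v g)) ?sumr_const ?oZ.
    by rewrite -[v g *+ p]mulr_natl mulKf.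
  move=> z Zz; have [e Ee nc] : exists2 e, e \in E & [~ g, e]%g != 1%g.
    by apply: not_cent_commg; move: nHg; rewrite inE Pg.
  have [||i <-] := conjg_coset_prime pr_oZ _ _ nc Zz.
  - by apply: (subsetP _ e Ee); rewrite centsC; apply: (subset_trans cZP);
    apply: centS.
  - by rewrite -invg_comm groupV (subsetP cEP) // mem_commg.
  by rewrite vJ // groupX // (subsetP sEP).
pose Phi (Y : {group gT}) := \sum_(x in Y) v (g * x)%g.
have PhiJ (Y : {group gT}) y : y \in P ->
    \sum_(x in Y) v (g ^ y * x)%g = Phi (Y :^ y^-1)%G.
  move=> Py; rewrite /Phi big_imset /=; last by move=> ? ? _ _ /conjg_inj.
  by apply: eq_bigr => x _; rewrite -(vJ (g * _)%g y Py) conjMg conjgKV.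
have -> : \sum_(y in P) (dX - dE) (g ^ y)%g =
  p%:R^-1 * (\sum_(y in P) Phi (X :^ y)%G) - (p ^ 2)%:R^-1 * (Phi E *+ #|P|).
  rewrite [\sum_(y in P) Phi _](reindex_inj invg_inj) /=.
  rewrite [X in _ = _ * X - _](eq_bigl (mem P)) => [|y]; last exact: groupV.
  rewrite -sumr_const mulr_sumr [X in _ = _ - X]mulr_sumr -sumrB;
    apply: eq_bigr => y Py.
  have Hgy : (g ^ y)%g \in H by rewrite memJ_norm // (subsetP (normal_norm nHP)).
  rewrite cfunE [X in _ + X]cfunE dXE // dEE // !PhiJ // oE (oB _ XB).
  congr (_ - _ * Phi _); apply: group_inj => /=.
  by have/normsP/(_ y^-1%g) -> := normal_norm nEP; rewrite ?groupV.
have := @orbit_sum _ _ _ _ 'JG P X Phi (subsetT P); rewrite astab1JG defNX eOrb /=.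
move=> ->; rewrite -[\sum_(x in Z) _]/(Phi Z).
have : \sum_(Y in between 1%G E :\ Z) Phi Y = Phi E + v g *+ p - Phi Z.
  apply/eqP; rewrite eq_sym subr_eq; apply/eqP; rewrite [RHS]addrC.
  have <- : \sum_(Y in between 1%G E) Phi Y = Phi E + v g *+ p.
    rewrite /Phi (psection_sum p_pr _ sec).
    by rewrite -[1%G : {set gT}]/[set 1%g] big_set1 mulg1.
  by rewrite (big_setD1 Z).
move->; have H0 : #|H|%:R != 0 :> algC by rewrite neq0CG.
rewrite oP natrX -[(_ - _) *+ _]mulr_natl -[_ *+ (p * _)]mulr_natl natrM.
rewrite -[v g *+ p]mulr_natl.
move: (v g) (Phi Z) (Phi E) p0 H0; move: (p%:R : algC) (#|H|%:R : algC).
by move=> q h x y z q0 h0; field; rewrite h0 q0.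
Qed.

(** * The Ritter-Segal theorem: groups of normal rank one *)

Lemma Ind1E (gT : finGroupType) (P H : {group gT}) g : H \subset P ->
  'Ind[P, H] 1 g = #|H|%:R^-1 * \sum_(h in H) \sum_(y in P) (g ^ y == h)%g%:R.
Proof.
move=> sHP; rewrite cfIndE // exchange_big /=; congr (_ * _).
apply: eq_bigr => y Py; rewrite cfun1E.
have [Hgy|nHgy] := boolP (_ \in H); last first.
  by rewrite big1 // => h Hh; case: eqP nHgy => // ->; rewrite Hh.
rewrite (bigD1 _ Hgy) /= eqxx big1 ?addr0 // => h /andP[_].
by rewrite eq_sym => /negPf->.
Qed.

(** Both sides count, for the conjugates of g, the elements of S, of T and
    of the intermediate groups, and these counts are related by the covering
    of the plane T / S by its lines. *)
Lemma psection_Ind (p : nat) (gT : finGroupType) (P S T : {group gT}) :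
  prime p -> T \subset P -> psection p S T ->
  'Ind[P, S] 1 + 'Ind[P, T] 1 *+ p = \sum_(X in between S T) 'Ind[P,
    X] (1 : 'CF(X)).
Proof.
move=> p_pr sTP sec; have sST := psection_subl sec.
apply/cfun_inP=> g Pg; rewrite -scaler_nat cfunE [X in _ + X]cfunE sum_cfunE.
pose F h : algC := \sum_(y in P) (g ^ y == h)%g%:R.
rewrite !Ind1E ?(subset_trans sST) // -[LHS]/(_ * (\sum_(h in S) F h) + _ * (_ *
  \sum_(h in T) F h)).
rewrite [RHS](eq_bigr (fun X : {group gT} => (p * #|S|)%:R^-1 * \sum_(h in X) F
  h)); last first.
  move=> X; rewrite inE => /andP[sSX sXT].
  by rewrite Ind1E ?(subset_trans (proper_sub sXT)) // (psection_mid_card p_pr sec).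
rewrite -mulr_sumr (psection_sum p_pr _ sec) (psection_card sec).
rewrite -[(\sum_(h in S) _) *+ p]mulr_natl !natrM.
have p0 : p%:R != 0 :> algC by rewrite pnatr_eq0 -lt0n prime_gt0.
have S0 : #|S|%:R != 0 :> algC by rewrite neq0CG.
move: (\sum_(h in S) _) (\sum_(h in T) _) p0 S0.
by move: (p%:R : algC) (#|S|%:R : algC) => q s x y q0 s0; field; rewrite q0 s0.
Qed.

Lemma Ind1J (gT : finGroupType) (P H : {group gT}) y : H \subset P -> y \in P ->
  'Ind[P, (H :^ y)%G] 1 = 'Ind[P, H] 1.
Proof.
move=> sHP Py; apply/cfun_inP=> g Pg.
have sHyP : (H :^ y)%G \subset P by rewrite /= conj_subG.
rewrite !cfIndE // cardJg; congr (_ * _).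
rewrite (reindex_inj (mulIg y)); apply: eq_big => w; first by rewrite groupMr.
by move=> Pw; rewrite !cfun1E /= conjgM memJ_conjg.
Qed.

(** The values of the character are rational, hence fixed by the field
    automorphism that raises the roots of unity of order dividing #[g] to
    the power k; on the linear constituents of the restriction to <[g]> this
    automorphism replaces g by g^k. *)
Lemma rat_char_expg (gT : finGroupType) (G : {group gT}) (V : representation rat
  G) g k :
  g \in G -> coprime k #[g] -> rat_char V (g ^+ k)%g = rat_char V g.
Proof.
move=> Gg cok; have [u uE] := Qn_aut_exists cok.
have sgG : <[g]> \subset G by rewrite cycle_subG.
have /char_sum_irr[r rE] : 'Res[<[g]> ] (rat_char V) \is a character.
  by apply/cfRes_char/cfRepr_char.
have resE x : x \in <[g]> -> rat_char V x = \sum_(i <- r) 'chi_i x.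
  by move=> gx; rewrite -sum_cfunE -rE cfResE.
(* Field automorphisms fix the rational number which is the trace of g. *)
have uV : u (rat_char V g) = rat_char V g by rewrite rat_charE ?fmorph_rat.
rewrite -uV !resE ?mem_cycle ?cycle_id // rmorph_sum; apply: eq_bigr => i _.
have lin : 'chi_i \is a linear_char by apply/irr_cyclic_lin/cycle_cyclic.
by rewrite lin_charX ?cycle_id // uE // lin_char_unity_root ?cycle_id.
Qed.

(** The cyclic group <[g]> contains Z, the only subgroup of order p of A,
    and is larger than Z. Hence z = g^m with p dividing m, and k = m + 1. *)
Lemma cyclic_coset_generates (p : nat) (gT : finGroupType) (A Z : {group gT}) g z :
  prime p -> p.-group A -> cyclic A -> Z \subset A -> #|Z| = p -> g \in A ->
    g \notin Z ->
  z \in Z -> exists2 k, coprime k #[g] & (g * z = g ^+ k)%g.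
Proof.
move=> p_pr pA cA sZA oZ Ag nZg Zz.
have sgA : <[g]> \subset A by rewrite cycle_subG.
have ntg : <[g]> != 1%g by apply: contra nZg; rewrite cycle_eq1 => /eqP->.
have [_ + _] := pgroup_pdiv (pgroupS sgA pA) ntg.
move=> /(Cauchy p_pr)[x gx ox].
have sxA : <[x]> \subset A by rewrite cycle_subG (subsetP sgA).
have eZ : Z :=: <[x]> by apply/eqP; rewrite (eq_subG_cyclic cA) // oZ -orderE ox.
have sZg : Z \subset <[g]> by rewrite eZ cycle_subG.
have /cycleP[m em] : z \in <[g]> by apply: (subsetP sZg).
exists m.+1; last by rewrite em expgS.
have /p_natP[n on] : p.-nat #[g] := pgroupS sgA pA.
have pdm : (p %| m)%N.
  rewrite -[(_ %| _)%N]negbK -prime_coprime //; apply: contra nZg => co.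
  rewrite -cycle_subG; suff <- : <[z]> = <[g]> by rewrite cycle_subG.
  apply/eqP; rewrite eqEcard cycle_subG em mem_cycle /= -!orderE orderXgcd.
  by rewrite on (eqP (coprimeXl n co)) divn1.
rewrite on coprime_sym coprimeXl // prime_coprime //.
by rewrite -addn1 dvdn_addr // dvdn1 neq_ltn prime_gt1 ?orbT.
Qed.

(** Translation by w multiplies the sum by the conjugate of lam w, which is
    not 1. *)
Lemma lin_char_orthog (gT : finGroupType) (A B : {group gT}) (lam : 'CF(A)) w
    (F : gT -> algC) : lam \is a linear_char -> B \subset A -> w \in B ->
  lam w != 1 -> {in B, forall b, F (b * w)%g = F b} ->
  \sum_(b in B) F b * (lam b)^* = 0.
Proof.
move=> lin sBA Bw lamw FwE; set S := \sum_(b in B) _.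
have Sw : S = S * (lam w)^*.
  rewrite {1}/S (reindex_inj (mulIg w)) /= mulr_suml.
  apply: eq_big => b; first by rewrite groupMr.
  rewrite (groupMr _ Bw) => Bb;
    by rewrite FwE // (lin_charM lin) ?(subsetP sBA) // rmorphM mulrA.
apply/eqP; have : S * ((lam w)^* - 1) == 0 by rewrite mulrBr -Sw mulr1 subrr.
by rewrite mulf_eq0 => /orP[//|];
  rewrite subr_eq0 -{1}(rmorph1 Num.conj) (inj_eq (inv_inj conjCK)) (negPf lamw).
Qed.

(** Let u be the part of the character without Z-fixed vectors. Any g
    outside Z is conjugate to g z, or generates the same cyclic group, for
    all z in Z, so that u (g z) does not depend on z; as these values have
    sum 0, u vanishes outside Z. On Z it takes one value at 1 and another
    one elsewhere, with sum 0, so it is proportional to the difference of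
    the two permutation characters, and the multiplicity of lam in its
    restriction to A gives the factor. *)
Lemma cyclic_support_multiple (p : nat) (gT : finGroupType) (P A Z : {group gT})
    (V : representation rat P) (dZ : 'CF(P)) (lam : 'CF(A)) :
  prime p -> p.-group P -> cyclic A -> A \subset P -> Z \subset A ->
  Z \subset 'Z(P) -> #|Z| = p ->
  (forall g z, g \in P -> g \notin A -> z \in Z ->
     exists2 y, y \in P & (g ^ y = g * z)%g) ->
  (forall g, g \in P -> dZ g = p%:R^-1 * \sum_(z in Z) rat_char V (g * z)%g) ->
  lam \is a linear_char -> ~~ (Z \subset cfker lam) ->
  #|P : A|%:R *: (rat_char V - dZ) =
    '['Res[A] (rat_char V), lam] *: ('Ind[P, 1%G] 1 - 'Ind[P, Z] 1).
Proof.
move=> p_pr pP cA sAP sZA sZZ oZ out dZE lin /subsetPn[w Zw].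
have [sZP cZP] := subsetIP sZZ; have nZP : Z <| P by apply: sub_center_normal.
have pA := pgroupS sAP pP.
rewrite cfkerEchar ?lin_charW // inE (subsetP sZA) //= (lin_char1 lin) => lamw.
have [prZ w1] : prime #|Z| /\ w != 1%g.
  by rewrite oZ; split=> //; apply: contra lamw => /eqP->; rewrite lin_char1.
set v := rat_char V in dZE *.
have vX g k : g \in P -> coprime k #[g] -> v (g ^+ k)%g =
  v g by apply: rat_char_expg.
have vJ g y : y \in P -> v (g ^ y)%g = v g by apply: cfunJ.
clearbody v.
have vZ : {in Z, forall z, z != 1%g -> v z = v w}.
  move=> z Zz z1; have ow : #[w] = p.
    by rewrite -oZ; apply: (prime_nt_dvdP prZ); rewrite ?order_eq1 ?order_dvdG.
  have eZ : Z :=: <[w]>.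
    by apply/esym/eqP; rewrite eqEcard cycle_subG Zw oZ -orderE ow /=.
  have /cycleP[i ei] : z \in <[w]> by rewrite -eZ.
  rewrite ei vX ?(subsetP sZP) // ow coprime_sym prime_coprime // -ow.
  by rewrite order_dvdn -ei.
pose t := v 1%g; pose c := v w.
have vsum : \sum_(z in Z) v z = t + (p%:R - 1) * c.
  rewrite (bigD1 1%g) //= (eq_bigr (fun=> c)) => [|z /andP[Zz z1]]; last exact: vZ.
  rewrite sumr_const -/t -[c *+ _]mulr_natl; congr (_ + _ * _).
  have := cardD1 1%g Z; rewrite group1 oZ => ->.
  rewrite natrD addrAC subrr add0r; congr (_%:R).
  by apply: eq_card => z; rewrite !inE andbC.
have p0 : p%:R != 0 :> algC by rewrite pnatr_eq0 -lt0n prime_gt0.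
pose u g := v g - dZ g.
have u0 g : g \in P -> g \notin Z -> u g = 0.
  move=> Pg nZg; rewrite /u dZE // (eq_bigr (fun=> v g)).
    by rewrite sumr_const oZ -[v g *+ p]mulr_natl mulKf // subrr.
  move=> z Zz; have [Ag|nAg] := boolP (g \in A); last first.
    by have [y Py <-] := out g z Pg nAg Zz; rewrite vJ.
  by have [k cok ->] := cyclic_coset_generates p_pr pA cA sZA oZ Ag nZg Zz;
    rewrite vX.
have uZ z : z \in Z -> u z = v z - p%:R^-1 * (t + (p%:R - 1) * c).
  move=> Zz; rewrite /u dZE ?(subsetP sZP) //; congr (_ - _ * _).
  rewrite -vsum [RHS](reindex_inj (mulgI z)) /=.
  by apply: eq_bigl => y; rewrite groupMl.
have dZw g : g \in P -> dZ (g * w)%g = dZ g.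
  move=> Pg; rewrite !dZE ?groupM ?(subsetP sZP w) //; congr (_ * _).
  rewrite [RHS](reindex_inj (mulgI w)) /=.
  by apply: eq_big => y; rewrite ?groupMl // mulgA.
have kE : '['Res[A] v, lam] = #|A|%:R^-1 * (t - c).
  rewrite cfdotE; congr (_ * _).
  rewrite (eq_bigr (fun a => u a * (lam a)^* + dZ a * (lam a)^*)); last first.
    by move=> a Aa; rewrite cfResE // -mulrDl subrK.
  rewrite big_split /= (lin_char_orthog (F :=
    dZ) lin (subxx A) (subsetP sZA _ Zw) lamw).
    2: by move=> a Aa; rewrite dZw ?(subsetP sAP).
  rewrite addr0 (bigID (mem Z)) /= [X in _ + X]big1 ?addr0; last first.
    by move=> a /andP[Aa nZa]; rewrite u0 ?mul0r ?(subsetP sAP).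
  rewrite (eq_bigl (mem Z)) => [|a]; last first.
    by rewrite andb_idl //; apply: (subsetP sZA).
  have := lin_char_orthog (F := fun=> 1) lin sZA Zw lamw (fun _ _ => erefl).
  rewrite (bigD1 1%g) //= [in X in _ -> X = _](bigD1 1%g) //=.
  rewrite lin_char1 // rmorph1 !mulr1 => /eqP; rewrite addrC addr_eq0 => /eqP e.
  rewrite (eq_bigr (fun a => (c - p%:R^-1 * (t + (p%:R - 1) * c)) * (1 * (lam
    a)^*))).
    rewrite -mulr_sumr e uZ // -/t; by field.
  by move=> z /andP[Zz z1]; rewrite uZ // vZ // mul1r.
rewrite kE; apply/cfun_inP=> g Pg;
  rewrite cfunE [X in _ * X]cfunE [X in _ + X]cfunE.
rewrite -/(u g) cfunE [X in _ = _ * X]cfunE [X in _ = _ * (_ + X)]cfunE.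
rewrite !cfInd_cfun1 ?normal1 // !cfunE !cfuniE ?normal1 //.
rewrite indexg1 -!divgS // oZ !natf_div ?cardSg //; last by rewrite -oZ cardSg.
have A0 : #|A|%:R != 0 :> algC by rewrite neq0CG.
have [Zg|nZg] := boolP (g \in Z); last first.
  have -> : (g \in 1%G) = false.
    by apply/negP=> /set1P g1; rewrite g1 group1 in nZg.
  by rewrite u0 // !mulr0 subrr mulr0.
rewrite uZ //; have [->|g1] := eqVneq g 1%g.
  rewrite group1 -/t !mulr1n;
    move: (#|A|%:R : algC) (#|P|%:R : algC) (p%:R : algC) A0 p0 => a q r a0 r0.
  by field; rewrite a0 r0.
have -> : (g \in 1%G) = false by apply/negP=> /set1P g1'; rewrite g1' eqxx in g1.
rewrite vZ // -/c mulr0n mulr1n;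
  move: (#|A|%:R : algC) (#|P|%:R : algC) (p%:R : algC) A0 p0 => a q r a0 r0.
by field; rewrite a0 r0.
Qed.

(** The inner product is the dimension r of the lam-eigenspace of A. Complex
    conjugation followed by j is a conjugate-linear map J of this
    eigenspace, because j inverts A, and J^2 is multiplication by lam (j^2)
    = -1. If C is the matrix of J then the product of C with its conjugate
    is -1, so (-1)^r is the squared absolute value of det C, and r is even. *)
Lemma quaternionic_even (gT : finGroupType) (P A : {group gT}) (j : gT)
    (V : representation rat P) (lam : 'CF(A)) :
  A \subset P -> lam \is a linear_char -> j \in P ->
  {in A, forall a, (a ^ j)%g = a^-1%g} -> (j ^+ 2)%g \in A -> lam (j ^+ 2)%g = -1 ->
  exists m, '['Res[A] (rat_char V), lam] = m.*2%:R.
Proof.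
move=> sAP lin Pj invj Ajj lamjj; have sAPs := subsetP sAP.
pose rho := map_repr (ratr : rat -> algC) V; set n := rdegree V in rho.
have rhoC x : map_mx Num.conj (rho x) = rho x.
  by apply/matrixP=> i k; rewrite !mxE fmorph_div !rmorph_int.
(* The projection onto the eigenspace of lam; its trace is both the rank of
   the eigenspace and the multiplicity of lam. *)
pose e := #|A|%:R^-1 *: \sum_(a in A) (lam a)^* *: rho a.
have A0 : #|A|%:R != 0 :> algC by rewrite neq0CG.
have lamN a : a \in A -> lam a * (lam a)^* = 1.
  by move=> Aa; rewrite -lin_charV_conj // -lin_charM ?groupV // mulgV lin_char1.
have tr_e : \tr e = '['Res[A] (rat_char V), lam].
  rewrite mxtraceZ raddf_sum cfdotE; congr (_ * _); apply: eq_bigr => a Aa.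
  rewrite /= mxtraceZ mulrC cfResE // rat_charE ?sAPs //.
  by rewrite /rho map_reprE trace_map_mx.
have eJ a : a \in A -> e *m rho a = lam a *: e.
  move=> Aa; rewrite /e -scalemxAl [RHS]scalerA [lam a * _]mulrC -[RHS]scalerA;
    congr (_ *: _).
  rewrite mulmx_suml scaler_sumr [RHS](reindex_inj (mulIg a)) /=.
  apply: eq_big => b; first by rewrite groupMr.
  move=> Ab; rewrite -scalemxAl -repr_mxM ?sAPs // lin_charM // rmorphM.
  by rewrite scalerA [lam a * _]mulrC -mulrA [_ * lam a]mulrC lamN // mulr1.
have fixe m (W : 'M_(m, n)) : (forall a, a \in A -> W *m rho a = lam a *: W) ->
  W *m e = W.
  move=> WE; rewrite -scalemxAr mulmx_sumr (eq_bigr (fun=> W)) => [|a Aa].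
    by rewrite sumr_const -scaler_nat scalerA mulVf // scale1r.
  by rewrite -scalemxAr WE // scalerA mulrC lamN // scale1r.
pose B := row_base e; pose r := \rank e.
have Bfree : row_free B by apply: row_base_free.
have [D BE] : exists D, B = D *m e by apply/submxP; rewrite eq_row_base.
have BJ a : a \in A -> B *m rho a = lam a *: B.
  by move=> Aa; rewrite BE -mulmxA eJ // -scalemxAr.
have tr_r : \tr e = r%:R.
  rewrite -{1}(mulmx_base e) mxtrace_mulC -/B.
  suffices -> : B *m col_base e = 1%:M by rewrite mxtrace1.
  apply: (row_free_inj Bfree).
  by rewrite mul1mx -mulmxA mulmx_base fixe.
exists r./2; rewrite -tr_e tr_r; congr (_%:R).
suffices: ~~ odd r by move/even_halfK->.
pose Bc := map_mx Num.conj B.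
have [C CE] : exists C, Bc *m rho j = C *m B.
  apply/submxP; rewrite eq_row_base -[_ *m rho j]fixe ?submxMl // => a Aa.
  have ajE : (j * a = a^-1 * j)%g by rewrite [RHS]conjgC conjVg invj // invgK.
  have Pa := sAPs a Aa.
  rewrite -mulmxA -(repr_mxM rho) // ajE repr_mxM ?groupV // mulmxA.
  rewrite -(rhoC a^-1%g) -map_mxM BJ ?groupV // map_mxZ lin_charV_conj //.
  by rewrite [X in X *: _]conjCK -scalemxAl.
have CC : map_mx Num.conj C *m C = - 1%:M.
  apply: (row_free_inj Bfree).
  have BjE : B *m rho j = map_mx Num.conj C *m Bc.
    by rewrite -map_mxM -CE map_mxM rhoC -map_mx_comp map_mx_id // => x;
      apply: conjCK.
  rewrite -mulmxA -CE mulmxA -BjE -mulmxA -(repr_mxM rho) // -[(j * j)%g]/(j ^+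
    2)%g BJ // lamjj.
  by rewrite scaleN1r mulNmx mul1mx.
have := mul_conjC_ge0 (\det C); rewrite mulrC -det_map_mx -det_mulmx CC.
rewrite -scaleN1r detZ det1 mulr1 -signr_odd.
by case: (odd r) => //; rewrite expr1 oppr_ge0 ler10.
Qed.

Lemma central_prime_subgroup (p : nat) (gT : finGroupType) (P : {group gT}) :
  prime p -> p.-group P -> P :!=: 1%g ->
  exists2 Z : {group gT}, Z \subset 'Z(P) & #|Z| = p.
Proof.
move=> p_pr pP ntP.
have ntZ : 'Z(P) != 1%g.
  by have := meet_center_nil (pgroup_nil pP) (normal_refl P) ntP;
    rewrite (setIidPr (center_sub P)).
have [_ /(Cauchy p_pr)[z Zz oz] _] := pgroup_pdiv (pgroupS (center_sub P) pP) ntZ.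
by exists <[z]>%G; rewrite ?cycle_subG.
Qed.

(** The kernels of the irreducible characters have trivial intersection. *)
Lemma lin_char_nontrivial (gT : finGroupType) (A Z : {group gT}) :
  cyclic A -> Z \subset A -> Z :!=: 1%g ->
  exists2 lam : 'CF(A), lam \is a linear_char & ~~ (Z \subset cfker lam).
Proof.
move=> cA sZA ntZ.
have [i nk|nk] := pickP [pred i | ~~ (Z \subset cfker 'chi[A]_i)].
  by exists 'chi_i; first exact: irr_cyclic_lin.
case/eqP: ntZ; apply/trivgP; rewrite -(TI_cfker_irr A); apply/bigcapsP=> i _.
by have /negbFE := nk i.
Qed.

(** A central subgroup of order 2 lies in A = 'C_P(U), where it is the only
    subgroup of order 2, so it lies in U. An element outside A does not
    centralise U, and its commutators with U lie in Z. *)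
Lemma cyclic_cent4_center (gT : finGroupType) (P A U Z : {group gT}) :
  2.-group P -> cyclic_cent4 P A U -> Z \subset 'Z(P) -> #|Z| = 2%N ->
  [/\ Z \subset U, U <| P & forall g, g \in P -> g \notin A ->
    exists2 u, u \in U & [~ g, u]%g \in Z /\ [~ g, u]%g != 1%g].
Proof.
move=> pP [[cA sAP] iA sUA oU cUA] sZZ oZ; have [sZP cZP] := subsetIP sZZ.
have sUP := subset_trans sUA sAP.
have sZA : Z \subset A.
  by rewrite -cUA subsetI sZP centsC (subset_trans sUP) // centsC.
have sZU : Z \subset U by rewrite -(cardSg_cyclic cA) // oZ oU.
have nAP : A <| P by apply: index2_normal.
have nUP : U <| P by apply: char_normal_trans nAP; rewrite sub_cyclic_char.
have cUP : [~: U, P] \subset Z.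
  by apply: (central_chief pP sZZ sZU nUP); rewrite -divgS // oU oZ.
split=> // g Pg; rewrite -cUA inE Pg /= => /not_cent_commg[u Uu nu].
by exists u => //; split=> //; rewrite -invg_comm groupV (subsetP cUP) // mem_commg.
Qed.

(** This is the relation of psection_Ind for the Klein four-group <[x]> Z;
    its two subgroups <[x]> and <[x z]> other than Z are conjugate, so that
    their terms agree. *)
Lemma Ind1_klein (gT : finGroupType) (P Z : {group gT}) x :
  Z \subset 'Z(P) -> #|Z| = 2%N -> x \in P -> #[x] = 2%N -> x \notin Z ->
  (forall z, z \in Z -> exists2 y, y \in P & (x ^ y = x * z)%g) ->
  'Ind[P, 1%G] 1 - 'Ind[P, Z] 1
    = ('Ind[P, <[x]>%G] 1 - 'Ind[P, (<[x]> <*> Z)%G] 1) *+ 2 :> 'CF(P).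
Proof.
move=> sZZ oZ Px ox nZx conjx; have [sZP cZP] := subsetIP sZZ.
set I := <[x]>%G; set T := (I <*> Z)%G.
have sIP : I \subset P by rewrite cycle_subG.
have sTP : T \subset P by rewrite join_subG sIP.
have cIZ : I \subset 'C(Z) by rewrite centsC (subset_trans cZP) // centS.
have defT : T :=: (I * Z)%g by rewrite /T /= cent_joinEl.
have tiIZ : I :&: Z = 1%g.
  by apply: prime_TIg; rewrite -?orderE ?ox // cycle_subG.
have oT : #|T| = 4%N by rewrite defT (TI_cardMg tiIZ) -orderE ox oZ.
have sec : psection 2 1%G T.
  split; [exact: normal1 | by rewrite indexg1 oT | move=> t].
  rewrite defT => /mulsgP[a z Ia Zz ->].
  rewrite expgMn; last by apply: (centsP cIZ).
  rewrite (_ : a ^+ 2 = 1)%g; last by apply/eqP; rewrite -order_dvdn -ox order_dvdG.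
  by rewrite mul1g inE -order_dvdn -oZ order_dvdG.
have ZB : Z \in between 1%G T.
  rewrite inE proper1G -cardG_gt1 oZ /= properEcard joing_subr /=.
  by rewrite oZ [#|_|]oT.
have := psection_Ind (isT : prime 2) sTP sec.
rewrite (big_setD1 Z) //= (eq_bigr (fun=> 'Ind[P, I] 1)) => [|X].
  rewrite sumr_const; have := cardsD1 Z (between 1%G T);
    rewrite (card_between _ sec) // ZB add1n => -[<-] e.
  by apply/eqP; rewrite mulrnBl subr_eq addrAC eq_sym subr_eq e addrC.
rewrite !inE => /and3P[neXZ s1X prXT].
have oX : #|X| = 2%N by rewrite (psection_mid_card _ sec) // cards1.
have /cyclicP[x' defX] : cyclic X by rewrite prime_cyclic // oX.
have ox' : #[x'] = 2%N by rewrite orderE -defX.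
have : x' \in T by rewrite -cycle_subG -defX proper_sub.
rewrite defT => /mulsgP[a z Ia Zz ex'].
have ea : a = x.
  have : a \in [set 1%g; x] by rewrite -cycle2g.
  rewrite !inE => /orP[/eqP a1|/eqP//]; case/negP: neXZ.
  apply/eqP/group_inj/eqP; rewrite eqEcard oX oZ defX cycle_subG.
  by rewrite ex' a1 mul1g Zz.
have [y Py exy] := conjx z Zz.
have -> : X = (I :^ y)%G by apply: group_inj; rewrite /= -cycleJ exy -ea -ex'.
exact: Ind1J.
Qed.

(** Every character of a rational representation of a p-group is an integral
    combination of permutation characters. The induction on the order of P
    uses a normal elementary abelian subgroup of order p^2 if there is one.
    Otherwise the part of the character without Z-fixed vectors is, with k
    the multiplicity of a faithful linear character of the cyclic subgroup
    A, k times (1_1 - 1_Z) / |P : A| induced to P. For cyclic P the index is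
    1. If the index is 2 and some involution x lies outside A, half of 1_1 -
    1_Z is already a difference of permutation characters, those of <[x]>
    and <[x]> Z; if there is no such x, P is a generalised quaternion group
    and k is even. *)
Theorem ritter_segal (p : nat) (gT : finGroupType) (P : {group gT})
    (V : representation rat P) : prime p -> p.-group P -> permlat (rat_char V).
Proof.
move=> p_pr.
suffices: forall n, ritter_segal_below p n by move=> IH pP; apply: (IH #|P|.+1).
elim=> [|n IHn] {}gT {V}P // pP; rewrite ltnS leq_eqVlt => /orP[/eqP oP|];
  last exact: IHn.
move=> V; have {}IHn : ritter_segal_below p #|P| by rewrite oP.
have [P1|ntP] := eqVneq (P : {set gT}) 1%g.
  have -> : rat_char V = 'Ind[P, P] 1 *+ rdegree V.
    apply/cfun_inP=> g Pg; have -> : g = 1%g by apply/set1P; rewrite -[[set _]]P1.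
    by rewrite -scaler_nat [RHS]cfunE cfRepr1 cfInd_id cfun11 mulr1.
  exact/permlatMn/permlat_perm.
have [Z sZZ oZ] := central_prime_subgroup p_pr pP ntP.
have [sZP cZP] := subsetIP sZZ; have nZP : Z <| P by apply: sub_center_normal.
have ntZ : Z :!=: 1%g by rewrite -cardG_gt1 oZ prime_gt1.
have [dZ LdZ dZE] := avg_permlat V pP IHn (subxx P) nZP ntZ; rewrite oZ in dZE.
rewrite -(subrK dZ (rat_char V)); apply: permlatD => //.
have Lperm (H : {group gT}) : H \subset P -> permlat ('Ind[P,
  H] 1) by apply: permlat_perm.
have knat (A : {group gT}) (lam : 'CF(A)) : A \subset P -> lam \is a linear_char ->
    '['Res[A] (rat_char V), lam] \in Num.nat.
  move=> sAP lin; apply: Cnat_cfdot_char; last exact: lin_charW.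
  exact/cfRes_char/cfRepr_char.
have [[E nEP pE]|cP|[p2 [A [U cAU]]]] := pgroup_trichotomy p_pr pP.
- apply: permlatB => //.
  have [sEZ|] := boolP (E \subset 'Z(P));
    first exact: (ritter_segal_central V pP IHn pE sEZ).
  exact: (ritter_segal_noncentral V pP IHn nEP pE).
- have [lam lin nlam] := lin_char_nontrivial cP sZP ntZ.
  have := cyclic_support_multiple p_pr pP cP (subxx P) sZP sZZ oZ _ dZE lin nlam.
  rewrite indexgg scale1r => ->; last by move=> g z ->.
  have /natrP[k ->] := knat P lam (subxx P) lin.
  by rewrite scaler_nat; apply/permlatMn/permlatB; apply: Lperm; rewrite ?sub1G.
rewrite {}p2 {IHn} in p_pr pP oZ dZE *; have [sZU nUP out] :=
  cyclic_cent4_center pP cAU sZZ oZ.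
have [[cA sAP] iA sUA oU cUA] := cAU; have sZA := subset_trans sZU sUA.
have sUP := subset_trans sUA sAP.
have {}out g z : g \in P -> g \notin A -> z \in Z -> exists2 y,
  y \in P & (g ^ y = g * z)%g.
  move=> Pg nAg Zz; have [u Uu [Zc nc]] := out g Pg nAg.
  have [||i ei] := conjg_coset_prime _ _ Zc nc Zz; first by rewrite oZ.
    by rewrite (subsetP _ u Uu) // centsC (subset_trans cZP) // centS.
  by exists (u ^+ i)%g => //; rewrite groupX // (subsetP sUP).
have [lam lin nlam] := lin_char_nontrivial cA sZA ntZ.
have := cyclic_support_multiple p_pr pP cA sAP sZA sZZ oZ out dZE lin nlam.
rewrite iA => vE.
have inj2 (a b : 'CF(P)) : 2%:R *: a = 2%:R *: b -> a = b.
  by apply: scalerI; rewrite pnatr_eq0.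
have [/existsP[x /and3P[Px nAx /eqP ox]]|noinv] := boolP [exists x, [&& x \in P,
  x \notin A & #[x] == 2%N]].
  have /natrP[k ek] := knat A lam sAP lin.
  have nZx : x \notin Z by apply: contra nAx; apply: (subsetP sZA).
  move: vE; rewrite (Ind1_klein sZZ oZ Px ox nZx (fun z => out x z Px nAx)) ek.
  rewrite -scaler_nat scalerA mulrC -scalerA => /inj2 ->.
  have sxP : <[x]> \subset P by rewrite cycle_subG.
  by rewrite scaler_nat; apply/permlatMn/permlatB; apply: Lperm;
    rewrite ?join_subG ?sxP.
(* The square of g lies in A, is centralised by g, and generates a subgroup
   which does not contain U, hence lies in Z; it is not 1 because g is not
   an involution. *)
have sq g : g \in P -> g \notin A -> (g ^+ 2)%g \in Z /\ (g ^+ 2)%g != 1%g.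
  move=> Pg nAg; have Ag2 : (g ^+ 2)%g \in A.
    have nAP : A <| P by apply: index2_normal.
    have NAg := subsetP (normal_norm nAP) g Pg.
    apply: coset_idr; rewrite ?groupX // morphX //.
    rewrite -iA -card_quotient ?normal_norm //.
    exact/expg_cardG/mem_quotient.
  have nU4 : ~~ (4 %| #[g ^+ 2])%N.
    rewrite -oU orderE (cardSg_cyclic cA) ?cycle_subG //.
    apply: contra nAg => sUg; rewrite -cUA inE Pg -sub_cent1 (subset_trans sUg) //.
    by rewrite cycle_subG groupX // cent1id.
  have g1 : (g ^+ 2)%g != 1%g.
    apply: contraNneq noinv => g1; apply/existsP; exists g; rewrite Pg nAg /=.
    apply/eqP/nt_prime_order => //.
    by apply: contraNneq nAg => ->.
  split=> //; have [k ek] := p_natP (mem_p_elt pP (groupX 2 Pg)).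
  have o2 : #[g ^+ 2]%g = 2%N.
    rewrite -order_eq1 ek in g1; rewrite ek in nU4 *.
    by case: k {ek} g1 nU4 => [|[|k]] //; rewrite !expnS mulnA dvdn_mulr.
  by rewrite -cycle_subG -(cardSg_cyclic cA) ?cycle_subG // -orderE o2 oZ.
have [j Pj nAj] : exists2 j, j \in P & j \notin A.
  by apply/subsetPn; rewrite -indexg_gt1 iA.
have [Zjj jj1] := sq j Pj nAj.
have Zeq z1 z2 : z1 \in Z -> z2 \in Z -> z1 != 1%g -> z2 != 1%g -> z1 = z2.
  move=> Z1 Z2 n1 n2; have : (#|Z :\ 1%g| = 1)%N.
    by have := cardsD1 1%g Z; rewrite group1 oZ => -[].
  move/eqP/cards1P=> [z0 e0].
  have : z1 \in [set z0] by rewrite -e0 !inE n1.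
  have : z2 \in [set z0] by rewrite -e0 !inE n2.
  by move=> /set1P-> /set1P->.
(* Both j and j a have as square the involution of Z. *)
have invj : {in A, forall a, (a ^ j)%g = a^-1%g}.
  move=> a Aa; have Pa := subsetP sAP a Aa.
  have nAja : (j * a)%g \notin A by rewrite groupMr.
  have [Z2 n2] := sq _ (groupM Pj Pa) nAja.
  have := Zeq _ _ Z2 Zjj n2 jj1 => e.
  have {}e : (a * (j * a))%g = j by apply: (mulgI j); rewrite mulgA; apply: e.
  by apply: (mulgI j); rewrite -[LHS]conjgC -{2}e mulgA mulgK.
have lamjj : lam (j ^+ 2)%g = -1.
  have Ajj := subsetP sZA _ Zjj.
  have : lam (j ^+ 2)%g ^+ 2 == 1.
    rewrite -lin_charX // -(lin_char1 lin); apply/eqP; congr (lam _).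
    by have := order_dvdG Zjj; rewrite oZ order_dvdn => /eqP.
  rewrite sqrf_eq1 => /orP[/eqP l1|/eqP//]; case/negP: nlam.
  apply/subsetP=> z Zz; rewrite cfkerEchar ?lin_charW // inE (subsetP sZA) //=
    lin_char1 //.
  by have [->|z1] := eqVneq z 1%g; rewrite ?lin_char1 // (Zeq z _ Zz Zjj z1 jj1) l1.
have [m em] := quaternionic_even V sAP lin Pj invj (subsetP sZA _ Zjj) lamjj.
move: vE; rewrite em -mul2n natrM -scalerA => /inj2 ->.
by rewrite scaler_nat; apply/permlatMn/permlatB; apply: Lperm; rewrite ?sub1G.
Qed.

(** * Rational class functions as solutions of the section relations *)

(** The trace counts the cosets H y fixed by g, and H y is fixed if and only
    if the conjugate of g by the inverse of y lies in H. *)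
Lemma coset_repr_char (gT : finGroupType) (P H : {group gT}) : H \subset P ->
  rat_char (coset_repr P H) = 'Ind[P, H] 1.
Proof.
move=> sHP; apply/cfun_inP=> g Pg; rewrite rat_charE // cfIndE //.
have H0 : #|H|%:R != 0 :> algC by rewrite neq0CG.
apply: (mulfI H0); rewrite mulVKf //.
rewrite [\tr _](eq_bigr (fun i => (enum_val i :* g == enum_val i)%g%:R));
  last first.
  by move=> i _; rewrite mxE.
rewrite rmorph_sum /=.
transitivity (\sum_(C in rcosets H P) #|H|%:R * (C :* g == C)%g%:R : algC).
  rewrite mulr_sumr [RHS]big_enum_val; apply: eq_bigr => i _.
  by rewrite ratr_nat.
rewrite [RHS](reindex_inj invg_inj) [RHS](eq_bigl (mem P)) => [|y];
  last exact: groupV.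
rewrite [RHS](set_partition_big _ (rcosets_partition sHP)) /=.
apply: eq_bigr => _ /rcosetsP[y Py ->].
rewrite -(card_rcoset H y) mulr_natl -sumr_const; apply: eq_bigr => z Hyz.
rewrite cfun1E -(rcoset_eqP Hyz) -rcosetM; congr (nat_of_bool _)%:R.
by apply/eqP/idP=> [/rcoset_eqP|] zg; [|apply/rcoset_eqP];
  move: zg; rewrite mem_rcoset /conjg invgK mulgA.
Qed.

(** The relation satisfied by the permutation modules Q[P/H], transposed to
    super class functions. *)
Definition section_relation (p : nat) (gT : finGroupType) (P : {group gT})
    (f : superclass P) (S T : {group gT}) :=
  f S + p%:Z * f T = \sum_(X in between S T) f X.

Lemma ratclass_section (p : nat) (gT : finGroupType) (P S T : {group gT})
    (f : superclass P) : prime p -> f \in @is_ratclass gT P -> T \subset P ->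
  psection p S T -> section_relation p f S T.
Proof.
move=> p_pr /asboolP[phi fE] sTP sec; have sST := psection_subl sec.
have sXP (X : {group gT}) : X \in between S T -> X \subset P.
  by rewrite inE => /andP[_ /proper_sub/subset_trans->].
rewrite /section_relation (eq_bigr (fun X => phi (linearization P X))) => [|X XB];
  last first.
  by rewrite fE ?sXP.
rewrite -raddf_sum -[p%:Z]natz mulr_natl !fE ?(subset_trans sST) // -raddfMn
  -raddfD.
congr (phi _); apply: val_inj.
rewrite raddfD raddfMn raddf_sum /= !coset_repr_char ?(subset_trans sST) //.
rewrite (psection_Ind p_pr sTP sec); apply: eq_bigr => X XB.
by rewrite coset_repr_char ?sXP.
Qed.

(** The Frattini quotient of a noncyclic p-group has rank at least 2, so it
    has an elementary abelian quotient of order p^2. *)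
Lemma noncyclic_psection (p : nat) (gT : finGroupType) (H : {group gT}) :
  prime p -> p.-group H -> ~~ cyclic H -> exists S : {group gT}, psection p S H.
Proof.
move=> p_pr pH ncH; have nPhi := Phi_normal H.
have abH := Phi_quotient_abelem pH.
have pHb := quotient_pgroup 'Phi(H) pH.
have [n oHb] := p_natP pHb.
have n2 : (1 < n)%N.
  rewrite ltnNge; apply: contra ncH => n1; apply: Phi_quotient_cyclic.
  case: n n1 oHb => [|[|//]] _ oHb.
    by rewrite (card1_trivg oHb) cyclic1.
  by rewrite prime_cyclic // oHb.
have [|Sb [sSH nSH oSb]] := normal_pgroup pHb (normal_refl _) (r := n - 2).
  by rewrite oHb pfactorK // leq_subr.
have [S defS sPS nS] := inv_quotientN nPhi nSH.
exists S; split=> //.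
  rewrite -(index_quotient_eq _ (normal_sub nS) (normal_norm nPhi)); last first.
    by apply: subset_trans sPS; apply: subsetIr.
  rewrite -defS -divgS // oHb oSb -expnB ?prime_gt0 ?leq_subr //.
  by rewrite subKn.
move=> t Ht; apply: (subsetP sPS); apply: coset_idr.
  by rewrite groupX // (subsetP (normal_norm nPhi)).
have NHt := subsetP (normal_norm nPhi) t Ht; rewrite morphX //.
by case/(abelemP p_pr): abH => _ -> //; apply: mem_quotient.
Qed.

Section SectionRelations.

Variables (p : nat) (gT : finGroupType) (P : {group gT}) (f : superclass P).
Hypotheses (p_pr : prime p) (pP : p.-group P).
Hypothesis frel : forall S T : {group gT}, T \subset P -> psection p S T ->
  section_relation p f S T.

(** The function on P with average f C over every cyclic subgroup C,
    obtained by Moebius inversion along the chain of subgroups of C: it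
    satisfies |C| f C - |C^p| f (C^p) = (|C| - |C^p|) theta g for a
    generator g of C. At g = 1 the formula gives f 1. *)
Let theta (g : gT) : algC :=
  (p%:R * (f <[g]>%G)%:~R - (f <[g ^+ p]>%G)%:~R) / (p%:R - 1).

Lemma superclass_conj (H : {group gT}) g : g \in P -> f (H :^ g)%G = f H.
Proof.
by case/andP: (superclassP f) => _ /forallP/(_ H)/forall_inP/(_ g)/[apply]/eqP.
Qed.

Let thetaJ g y : y \in P -> theta (g ^ y)%g = theta g.
Proof.
move=> Py; rewrite /theta -conjXg.
have cycJ x : <[x ^ y]>%G = (<[x]> :^ y)%G by apply: val_inj; rewrite /= cycleJ.
by rewrite !cycJ !superclass_conj.
Qed.

(** For cyclic H this is the choice of theta. For noncyclic H, both f and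
    the average of theta satisfy the relation of a section with top H, which
    expresses their value at H through values at smaller subgroups. *)
Lemma theta_sum (H : {group gT}) : H \subset P ->
  \sum_(h in H) theta h = #|H|%:R * (f H)%:~R.
Proof.
have p1 : p%:R - 1 != 0 :> algC.
  by rewrite subr_eq0 (eqr_nat _ p 1) neq_ltn prime_gt1 ?orbT.
have [n] := ubnP #|H|; elim: n => // n IH in H * => /ltnSE leHn sHP.
have IHn (X : {group gT}) : X \proper H -> \sum_(h in X) theta h =
  #|X|%:R * (f X)%:~R.
  move=> prX; apply: IH; first exact: leq_trans (proper_card prX) leHn.
  exact: subset_trans (proper_sub prX) sHP.
have pH := pgroupS sHP pP.
have [cH|ncH] := boolP (cyclic H); last first.
  have [S sec] := noncyclic_psection p_pr pH ncH.
  have p0 : p%:R != 0 :> algC by rewrite pnatr_eq0 -lt0n prime_gt0.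
  have prS : S \proper H.
    case: sec => /andP[sSH _] iS _; rewrite properE sSH -indexg_gt1 iS.
    by rewrite -(exp1n 2) ltn_exp2r ?prime_gt1.
  have := psection_sum p_pr theta sec; rewrite (IHn S prS).
  rewrite (eq_bigr (fun X : {group gT} => (p * #|S|)%:R * (f X)%:~R)) => [|X].
    have e : \sum_(X in between S H) (f X)%:~R =
      (f S)%:~R + p%:R * (f H)%:~R :> algC.
      by have /(congr1 (intr : int -> algC)) := frel sHP sec;
        rewrite rmorph_sum intrD intrM => <-.
    rewrite -mulr_sumr e => /eqP; rewrite -subr_eq => /eqP <-.
    rewrite (psection_card sec) !natrM -[X in _ - X]mulr_natl.
    move: (p%:R : algC) (#|S|%:R : algC) ((f S)%:~R : algC) ((f H)%:~R : algC).
    by move=> q s a b; ring.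
  rewrite inE => /andP[sSX sXH].
  by rewrite IHn // (psection_mid_card p_pr sec).
have [x defH] := cyclicP cH.
have Hx : x \in H by rewrite defH cycle_id.
have [H1|ntH] := eqVneq (H : {set gT}) 1%g.
  have -> : H = 1%G by apply: val_inj.
  rewrite big_set1 cards1 mul1r /theta expg1n.
  have -> : <[1%g : gT]>%G = 1%G by apply: val_inj; rewrite /= cycle1.
  by rewrite -{2}[(f _)%:~R]mul1r -mulrBl mulrAC divff // mul1r.
have [_ pdH [m oH]] := pgroup_pdiv pH ntH.
pose H' := <[x ^+ p]>%G.
have pdx : (p %| #[x])%N by rewrite orderE -defH.
have oH' : #|H| = (p * #|H'|)%N.
  by rewrite defH -[#|H'|]/#[(x ^+ p)%g] orderXdiv // mulnC divnK.
have sH'H : H' \subset H by rewrite defH cycleX.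
have prH' : H' \proper H.
  by rewrite properEcard sH'H oH' ltn_Pmull ?prime_gt1.
rewrite (big_setID H') /= (setIidPr sH'H) IHn //.
rewrite (eq_bigr (fun=> (p%:R * (f H)%:~R - (f H')%:~R) / (p%:R - 1))) => [|h].
  rewrite sumr_const cardsD (setIidPr sH'H) oH' -[X in _ + X]mulr_natl.
  rewrite natrB ?leq_pmull ?prime_gt0 // natrM.
  by field.
case/setDP=> Hh nH'h.
have eH : <[h]>%G = H.
  apply/group_inj/eqP; rewrite eqEcard cycle_subG Hh /= leqNgt.
  apply/negP=> lt; case/negP: nH'h; rewrite -cycle_subG -(cardSg_cyclic cH) //.
    have : (#|<[h]>| %| p ^ m.+1)%N by rewrite -oH cardSg // cycle_subG.
    case/(dvdn_pfactor _ _ p_pr) => k km ek.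
    have -> : #|H'| = (p ^ m)%N.
      by move/eqP: oH'; rewrite oH expnS eqn_pmul2l ?prime_gt0 // => /eqP.
    rewrite ek dvdn_exp2l // -ltnS -(ltn_exp2l _ _ (prime_gt1 p_pr)).
    by rewrite -ek -oH.
  by rewrite cycle_subG.
have eH' : <[h ^+ p]>%G = H'.
  apply/group_inj/eqP; rewrite (eq_subG_cyclic cH) ?cycleX ?cycle_subG ?groupX //.
  have oh : #[h] = #[x] by rewrite /order -defH -eH.
  rewrite -[#|<[h ^+ p]>|]/#[(h ^+ p)%g] -[#|H'|]/#[(x ^+ p)%g].
  by rewrite !orderXdiv ?oh.
by rewrite /theta eH eH'.
Qed.

Lemma Ind1_theta (H : {group gT}) : H \subset P ->
  #|P|%:R^-1 * (\sum_(g in P) 'Ind[P, H] 1 g * theta g) = (f H)%:~R.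
Proof.
move=> sHP; have H0 : #|H|%:R != 0 :> algC by rewrite neq0CG.
have P0 : #|P|%:R != 0 :> algC by rewrite neq0CG.
apply: (mulfI H0); rewrite -theta_sum // mulrCA; apply: (mulfI P0).
rewrite mulVKf // mulr_sumr.
rewrite (eq_bigr (fun g => \sum_(h in H) \sum_(y in P) (g ^ y == h)%g%:R * theta
  g)).
  rewrite exchange_big mulr_sumr; apply: eq_bigr => h Hh; rewrite exchange_big /=.
  rewrite mulr_natl -sumr_const; apply: eq_bigr => y Py.
  have Ph := subsetP sHP h Hh.
  rewrite (bigD1 (h ^ y^-1)%g) /=; last by rewrite groupJ ?groupV.
  rewrite conjgKV eqxx mul1r thetaJ ?groupV // big1 ?addr0 // => g /andP[_ ne].
  by case: eqP => [e|_]; rewrite ?mul0r //; case/eqP: ne; rewrite -e conjgK.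
move=> g Pg; rewrite Ind1E // mulrA mulVKf // mulr_suml.
by apply: eq_bigr => h Hh; rewrite mulr_suml.
Qed.

(** The linear form chi |-> (1/|P|) sum_g chi(g) theta(g) takes the value f
    H at the permutation character of P/H. It is therefore integral on the
    lattice of permutation characters, which by the Ritter-Segal theorem
    contains all rational characters. *)
Theorem section_ratclass : f \in @is_ratclass gT P.
Proof.
pose F (chi : 'CF(P)) := #|P|%:R^-1 * (\sum_(g in P) chi g * theta g).
have FB (a b : 'CF(P)) : F (a - b) = F a - F b.
  rewrite /F -mulrBr -sumrB; congr (_ * _); apply: eq_bigr => g _.
  by rewrite cfunE [X in _ + X]cfunE mulrBl.
have Fint (chi : ratchar P) : F chi \in Num.int.
  have /asboolP[V [W ->]] := ratcharP chi.
  have permF (a : 'CF(P)) : permlat a -> F a \in Num.int.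
    elim=> [H sHP|b c _ Fb _ Fc]; first by rewrite /F Ind1_theta // intr_int.
    by rewrite FB rpredB.
  by rewrite FB rpredB // permF //; apply: (ritter_segal _ p_pr).
pose phi (chi : ratchar P) : int := Num.floor (F chi).
have phiE chi : (phi chi)%:~R = F chi by apply/eqP; rewrite -intrEfloor.
have phiB : zmod_morphism phi.
  by move=> a b; apply: (@intr_inj algC); rewrite rmorphB /= !phiE -FB.
pose phiM := GRing.isZmodMorphism.Build _ _ phi phiB.
pose phiA : {additive ratchar P -> int} := HB.pack phi phiM.
apply/asboolP; exists phiA => H sHP /=.
by apply: (@intr_inj algC); rewrite phiE -Ind1_theta // /F /= coset_repr_char.
Qed.

End SectionRelations.

(** * Gluing data and their solutions *)

Section QuotientSections.

Variables (p : nat) (gT : finGroupType) (Q : {group gT}).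
Implicit Types S T : {group coset_of Q}.

Let pre S := (coset Q @*^-1 S)%G.

Lemma psection_cosetpre S T : psection p (pre S) (pre T) <-> psection p S T.
Proof.
rewrite /psection /= cosetpre_normal index_cosetpre.
split=> -[-> -> eT]; split=> // t Tt.
  have [x Nx ex] := cosetP t; subst t.
  have /morphpreP[_] := eT x (mem_morphpre Nx Tt).
  by rewrite (morphX (coset_morphism Q)).
case/morphpreP: Tt => Nt /eT; rewrite -(morphX (coset_morphism Q)) // => St.
by apply: mem_morphpre; rewrite ?groupX.
Qed.

(** The subgroups between the preimages of S and T contain Q and normalise
    it, so they are the preimages of the groups between S and T. *)
Lemma between_cosetpre_sum (R : zmodType) S T (F : {group gT} -> R) :
  \sum_(X in between (pre S) (pre T)) F X = \sum_(X in between S T) F (pre X).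
Proof.
rewrite (reindex_onto pre (fun X : {group gT} => (X / Q)%G)) => [|X]; last first.
  rewrite inE => /andP[/proper_sub sSX /proper_sub sXT].
  apply: group_inj; rewrite /= quotientGK //.
  rewrite /normal (subset_trans (sub_cosetpre _) sSX) /=.
  by rewrite (subset_trans sXT) // subsetIl.
apply: eq_bigl => X; rewrite !inE /= !cosetpre_proper.
by rewrite andb_idr // => _; apply/eqP/group_inj; rewrite /= cosetpreK.
Qed.

End QuotientSections.

Section Destriction.

Variables (p : nat) (gT : finGroupType) (P Q : {group gT}).
Hypotheses (p_pr : prime p) (pP : p.-group P) (sQP : Q \subset P).
Variables (f : superclass P) (fQ : superclass ('N_P(Q) / Q)%G).
Hypothesis des : is_destriction f fQ.

Lemma destriction_cosetpre (X : {group coset_of Q}) : X \subset ('N_P(Q) / Q)%g ->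
  fQ X = f (coset Q @*^-1 X)%G.
Proof.
move=> sX; have sQN : Q <| 'N_P(Q) by rewrite normal_subnorm.
have := @des (coset Q @*^-1 X)%G; rewrite /= sub_cosetpre.
have -> : (coset Q @*^-1 X / Q)%G = X by apply: group_inj; rewrite /= cosetpreK.
by apply=> //; rewrite -(quotientGK sQN) cosetpreSK.
Qed.

Lemma destriction_relation (S T : {group coset_of Q}) :
  T \subset ('N_P(Q) / Q)%g -> psection p S T ->
  section_relation p fQ S T <->
  section_relation p f (coset Q @*^-1 S)%G (coset Q @*^-1 T)%G.
Proof.
move=> sT sec; have sST := psection_subl sec.
rewrite /section_relation between_cosetpre_sum !destriction_cosetpre
  ?(subset_trans sST) //.
rewrite (eq_bigr (fun X : {group coset_of Q} => f (coset Q @*^-1 X)%G)) // => X.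
by rewrite inE => /andP[_ /proper_sub sX];
  rewrite destriction_cosetpre // (subset_trans sX).
Qed.

Lemma destriction_ratclass_section : fQ \in @is_ratclass _ ('N_P(Q) / Q)%G ->
  forall S T : {group gT}, Q \subset S -> T \subset 'N_P(Q) -> psection p S T ->
  section_relation p f S T.
Proof.
move=> rat S T sQS sTN sec; have sST := psection_subl sec.
have nQT : Q <| T.
  rewrite /normal (subset_trans sQS) //= (subset_trans sTN) // subsetIr //.
have nQS : Q <| S by apply: normalS nQT.
have eS : S = (coset Q @*^-1 (S / Q))%G by apply: group_inj; rewrite /= quotientGK.
have eT : T = (coset Q @*^-1 (T / Q))%G by apply: group_inj; rewrite /= quotientGK.
have sTQ : (T / Q)%g \subset ('N_P(Q) / Q)%g by apply: quotientS.
have secQ : psection p (S / Q)%G (T / Q)%G by apply/psection_cosetpre;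
  rewrite -eS -eT.
rewrite eS eT; apply/destriction_relation => //.
exact: ratclass_section.
Qed.

Lemma destriction_section_ratclass :
  (forall S T : {group gT}, Q \subset S -> T \subset 'N_P(Q) -> psection p S T ->
    section_relation p f S T) -> fQ \in @is_ratclass _ ('N_P(Q) / Q)%G.
Proof.
move=> rel; apply: (section_ratclass p_pr) => [|S T sT sec].
  exact/quotient_pgroup/(pgroupS (subsetIl _ _)).
apply/destriction_relation => //; apply: rel; rewrite ?sub_cosetpre //.
  have sQN : Q <| 'N_P(Q) by rewrite normal_subnorm.
  by rewrite -(quotientGK sQN) cosetpreSK.
exact/psection_cosetpre.
Qed.

End Destriction.

Lemma superclass_out (gT : finGroupType) (P : {group gT}) (f : superclass P) (H :
  {group gT}) : ~~ (H \subset P) -> f H = 0.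
Proof.
move=> nHP; case/andP: (superclassP f) => /forallP/(_ H) + _.
by rewrite (negPf nHP) => /eqP.
Qed.

Section Solutions.

Variables (p : nat) (gT : finGroupType) (P : {group gT}).
Hypotheses (p_pr : prime p) (pP : p.-group P).

(** The relations that gluing data can see: those which do not involve the
    value at the trivial subgroup. *)
Definition nontrivial_relations (f : superclass P) :=
  forall S T : {group gT}, S :!=: 1%g -> T \subset P -> psection p S T ->
  section_relation p f S T.

Lemma ntsubgroupE (Q : ntsubgroup P) : Q :!=: 1%g /\ Q \subset P.
Proof. by apply/andP; apply: ntsubgroupP. Qed.

Lemma insub_ntsubgroup (L : {group gT}) (ntL : (L :!=: 1%g) && (L \subset P)) :
  insub L = Some (NtSubgroup ntL).
Proof. by case: insubP => [Q _ eQ|]; [congr Some;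
  apply: val_inj | rewrite ntL]. Qed.

(** A section T / S with S nontrivial lies in 'N_P(S) / S, where s provides
    a rational class function. *)
Lemma solution_relations (s : gluing P) (f : superclass P) :
  is_solution s f -> nontrivial_relations f.
Proof.
move=> sol S T ntS sTP sec; have sST := psection_subl sec.
have ntS' : (S :!=: 1%g) && (S \subset P) by rewrite ntS (subset_trans sST).
have [_ sSP] := andP ntS'; pose Q := NtSubgroup ntS'.
have := @destriction_ratclass_section p gT P S p_pr sSP f (s Q) (sol Q).
apply=> //; first exact: ratclassP.
by case: sec => /andP[_ nST] _ _; rewrite subsetI sTP.
Qed.

Fact solution_superclass (s : gluing P) (c : int) :
  [ffun L : {group gT} => if L :==: 1%g then c else
     if insub L is Some Q then s Q (Q / Q)%G else 0] \in is_superclass P.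
Proof.
apply/andP; split; apply/forallP=> H.
  have [//|nHP] := boolP (H \subset P); rewrite ffunE.
  have [H1|ntH] := eqVneq (H : {set gT}) 1%g; first by rewrite H1 sub1G in nHP.
  by rewrite insubF // (negPf nHP) andbF.
apply/forall_inP=> g Pg; rewrite !ffunE /=.
have eJ1 : (H :^ g == 1)%g = (H :==: 1%g).
  by rewrite -{1}(conjs1g g) (inj_eq (@conjsg_inj _ g)).
rewrite eJ1.
have [//|ntH] := eqVneq (H : {set gT}) 1%g.
have [sHP|nsHP] := boolP (H \subset P); last first.
  rewrite !insubF //= ?(negPf nsHP) ?andbF //.
  by rewrite -(conjGid Pg) conjSg (negPf nsHP) andbF.
have ntH' : (H :!=: 1%g) && (H \subset P) by rewrite ntH.
have ntHg : ((H :^ g)%G :!=: 1%g) && ((H :^ g)%G \subset P).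
  by rewrite /= eJ1 ntH -(conjGid Pg) conjSg.
rewrite (insub_ntsubgroup ntH') (insub_ntsubgroup ntHg).
have /asboolP[sJ _] := gluingP s.
by apply/eqP/(sJ (NtSubgroup ntH') (NtSubgroup ntHg) g Pg) => //=;
  rewrite subsetI sHP normG.
Qed.

(** The value at a nontrivial subgroup L is that of the component s L at the
    trivial subgroup of 'N_P(L) / L; the value c at the trivial subgroup is
    free. *)
Definition solution (s : gluing P) (c : int) :=
  SuperClass (solution_superclass s c).

Lemma solution1 s c : solution s c 1%G = c.
Proof. by rewrite ffunE eqxx. Qed.

Lemma solutionP s c : is_solution s (solution s c).
Proof.
move=> Q L sQL sLN; have [ntQ sQP] := ntsubgroupE Q.
have sLP : L \subset P by apply: subset_trans sLN (subsetIl _ _).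
have ntL : (L :!=: 1%g) && (L \subset P).
  by rewrite sLP andbT; apply: contraNneq ntQ => L1; rewrite -subG1 -L1.
rewrite ffunE (negPf (andP ntL).1) (insub_ntsubgroup ntL) /=.
have /asboolP[_ sC] := gluingP s.
apply: (sC Q (NtSubgroup ntL)) => //=.
  by rewrite /normal sQL (subset_trans sLN) ?subsetIr.
by rewrite subsetI sLN subsetI sLP normG.
Qed.

(** A solution is determined away from the trivial subgroup by its component
    at L itself. *)
Lemma solution_unique (s : gluing P) (f g : superclass P) (L : {group gT}) :
  is_solution s f -> is_solution s g -> L :!=: 1%g -> f L = g L.
Proof.
move=> sf sg ntL; have [sLP|nLP] := boolP (L \subset P);
  last by rewrite !superclass_out.
have ntL' : (L :!=: 1%g) && (L \subset P) by rewrite ntL.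
have sLN : L \subset 'N_P(L) by rewrite subsetI sLP normG.
by rewrite -(sf (NtSubgroup ntL') L) // -(sg (NtSubgroup ntL') L).
Qed.

Lemma solution_inj (s t : gluing P) (f : superclass P) :
  is_solution s f -> is_solution t f -> s = t.
Proof.
move=> sf tf; apply/val_inj/ffunP=> Q; have [ntQ sQP] := ntsubgroupE Q.
apply/val_inj/val_inj/ffunP=> L.
have [sL|nL] := boolP (L \subset ('N_P(Q) / Q)%g); last by rewrite !superclass_out.
have := destriction_cosetpre sQP (sf Q) sL.
by rewrite -(destriction_cosetpre sQP (tf Q) sL).
Qed.

Lemma solutionB (s t : gluing P) (f g : superclass P) :
  is_solution s f -> is_solution t g -> is_solution (s - t) (f - g).
Proof.
move=> sf tg Q L sQL sLN.
have -> : gluing_fun (s - t) Q = s Q - t Q by exact: famBE.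
rewrite /= !ffunE.
by rewrite -(sf Q L) // -(tg Q L).
Qed.

Fact destriction_superclass (f : superclass P) (Q : {group gT}) :
  [ffun L : {group coset_of Q} => if L \subset ('N_P(Q) / Q)%g
     then f (coset Q @*^-1 L)%G else 0] \in is_superclass ('N_P(Q) / Q)%G.
Proof.
apply/andP; split; apply/forallP=> H; first by rewrite ffunE; case: ifP.
apply/forall_inP=> _ /morphimP[g Ng Pg ->]; rewrite !ffunE /=.
have Pgb : coset Q g \in ('N_P(Q) / Q)%g by apply: mem_quotient.
rewrite -{1}(conjGid Pgb) conjSg; case: ifP => // _.
rewrite -(superclass_conj f (coset Q @*^-1 H)%G (subsetP (subsetIl _ _) g Pg)).
by apply/eqP; congr (f _); apply: group_inj; rewrite /= morphpreJ.
Qed.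

Definition destriction (f : superclass P) (Q : {group gT}) :=
  SuperClass (destriction_superclass f Q).

Lemma destrictionP (f : superclass P) (Q : {group gT}) : Q \subset P ->
  is_destriction f (destriction f Q).
Proof.
move=> sQP L sQL sLN; rewrite ffunE quotientS //; congr (f _).
apply: group_inj; rewrite /= quotientGK //.
by rewrite /normal sQL (subset_trans sLN) ?subsetIr.
Qed.

(** The destrictions of f are rational class functions because every section
    of 'N_P(Q) / Q comes from a section T / S of P with Q <= S. *)
Lemma relations_gluing (f : superclass P) : nontrivial_relations f ->
  exists s : gluing P, is_solution s f.
Proof.
move=> rel.
have rat (Q : ntsubgroup P) : destriction f Q \in @is_ratclass _ ('N_P(Q) / Q)%G.
  have [ntQ sQP] := ntsubgroupE Q.
  apply: (destriction_section_ratclass p_pr pP sQP (@destrictionP f Q sQP)).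
  move=> S T sQS sTN sec; apply: rel => //.
    by apply: contraNneq ntQ => S1; rewrite -subG1 -S1.
  by apply: subset_trans sTN (subsetIl _ _).
pose s : ratclass_family P := [ffun Q => RatClass (rat Q)].
have sE (Q : ntsubgroup P) (L : {group gT}) : Q \subset L -> L \subset 'N_P(Q) ->
    s Q (L / Q)%G = f L.
  have [_ sQP] := ntsubgroupE Q.
  by move=> sQL sLN; rewrite ffunE /=; apply: (@destrictionP f Q sQP).
have gl : s \in @is_gluing _ P.
  apply/asboolP; split=> [Q R g Pg eR L sQL sLN | Q R nQR L sRL].
    rewrite !sE //= ?superclass_conj // ?eR ?conjSg //.
    by rewrite -{1}(conjGid Pg) normJ -conjIg conjSg.
  rewrite subsetI => /andP[sLQ sLR].
  by rewrite !sE // (subset_trans (normal_sub nQR)).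
by exists (Gluing gl) => Q L; apply: sE.
Qed.

End Solutions.

(** * The function attached to a solution *)

Section Abelem.

Variables (p : nat) (gT : finGroupType).
Hypothesis p_pr : prime p.
Implicit Types P D E F S T X Y : {group gT}.

Lemma abelem_psection S T : p.-abelem T -> S \subset T -> #|T| = (p ^ 2 * #|S|)%N ->
  psection p S T.
Proof.
move=> abT sST oT; have [cTT eT] := abelemP p_pr abT; split.
- by rewrite -sub_abelian_normal.
- by rewrite -divgS // oT mulnK ?cardG_gt0.
by move=> t Tt; rewrite eT // group1.
Qed.

Lemma abelem_joing E F : p.-abelem E -> p.-abelem F -> E \subset 'C(F) ->
  p.-abelem (E <*> F).
Proof.
move=> abE abF cEF.
have [cEE eE] := abelemP p_pr abE; have [cFF eF] := abelemP p_pr abF.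
apply/(abelemP p_pr); rewrite /= cent_joinEl //; split=> [|_ /mulsgP[x y Ex Fy ->]].
  by rewrite abelianM cEE cFF /= centsC.
by rewrite expgMn ?(eE x) ?(eF y) ?mulg1 //; apply: (centsP cEF).
Qed.

Lemma abelem_cycle E x : p.-abelem E -> x \in E -> x != 1%g -> #|<[x]>| = p.
Proof. by move=> abE Ex nx; rewrite -orderE (abelem_order_p abE). Qed.

Lemma abelem_extend E X x : p.-abelem E -> X \subset E -> x \in E -> x \notin X ->
  #|X <*> <[x]>| = (#|X| * p)%N.
Proof.
move=> abE sXE Ex nXx; have nx : x != 1%g by apply: contraNneq nXx => ->.
have ox := abelem_cycle abE Ex nx.
have cXx : X \subset 'C(<[x]>).
  by rewrite (sub_abelian_cent2 (abelem_abelian abE)) // cycle_subG.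
rewrite /= cent_joinEl // TI_cardMg ?ox // setIC; apply: prime_TIg; rewrite ?ox //.
by rewrite cycle_subG.
Qed.

Lemma p2Elem_card P D : D \subset P -> p.-abelem D -> #|D| = (p ^ 2)%N ->
  D \in 'E_p^2(P).
Proof. by move=> sDP abD oD; apply/pnElemP; split=> //; rewrite oD pfactorK. Qed.

End Abelem.

Section Tilde.

Variables (p : nat) (gT : finGroupType) (P : {group gT}).
Hypotheses (p_pr : prime p) (pP : p.-group P).
Implicit Types D E F S T X Y : {group gT}.

Definition tilde (f : superclass P) E : int :=
  \sum_(X in between 1%G E) f X - p%:Z * f E.

Lemma tildeJ f E g : g \in P -> tilde f (E :^ g)%G = tilde f E.
Proof.
move=> Pg; rewrite /tilde superclass_conj //; congr (_ - _).
have inj : injective (fun X : {group gT} => (X :^ g)%G).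
  by move=> X Y /(congr1 val)/= /conjsg_inj e; apply: group_inj.
rewrite (reindex_inj inj); apply: eq_big => X; last by rewrite superclass_conj.
by rewrite !inE !proper1G /= properJ -{1}(conjs1g g) (inj_eq (@conjsg_inj _ g)).
Qed.

Definition rank2 F := [set Y : {group gT} | (Y \subset F) && (#|Y| == p ^ 2)%N].

(** Expand each f X through the section F / X. A subgroup Y of order p^2 of
    F then occurs once for every subgroup of order p of D contained in Y,
    that is p + 1 times if Y = D and once otherwise, since D and Y meet in a
    subgroup of order p. The surplus p f D cancels the last term of tilde f
    D, and what remains does not depend on D. *)
Lemma tilde_rank3 f F D : nontrivial_relations p f -> F \subset P -> p.-abelem F ->
  #|F| = (p ^ 3)%N -> D \in rank2 F ->
  tilde f D = \sum_(Y in rank2 F) f Y - (p%:Z + 1) * (p%:Z * f F).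
Proof.
move=> rel sFP abF oF D2; have [sDF oD] : D \subset F /\ #|D| = (p ^ 2)%N.
  by move: D2; rewrite inE => /andP[-> /eqP->].
have p_gt0 := prime_gt0 p_pr; have p_gt1 := prime_gt1 p_pr.
have secD : psection p 1%G D.
  by apply: abelem_psection; rewrite ?sub1G ?oD ?cards1 ?muln1 // (abelemS sDF).
have oX X : X \in between 1%G D -> #|X| = p.
  rewrite inE => /andP[s1X sXD].
  by rewrite (psection_mid_card p_pr secD) // cards1 muln1.
have sXD X : X \in between 1%G D -> X \subset D.
  by rewrite inE => /andP[_ /proper_sub].
have secX X : X \in between 1%G D -> psection p X F.
  move=> XB; apply: abelem_psection => //; first exact: subset_trans (sXD X XB) sDF.
  by rewrite oF oX // expnSr.
have fX X : X \in between 1%G D ->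
    f X = \sum_(Y in rank2 F | X \subset Y) f Y - p%:Z * f F.
  move=> XB; have ntX : X :!=: 1%g by rewrite -cardG_gt1 oX.
  have := rel X F ntX sFP (secX X XB); rewrite /section_relation => e.
  rewrite -[LHS](addrK (p%:Z * f F)) e; congr (_ - _).
  apply: eq_bigl => Y; rewrite !inE !properEcard oX // oF.
  apply/idP/idP=> [/andP[/andP[sXY ltX] /andP[sYF ltY]]|/andP[/andP[sYF /eqP oY]
    sXY]].
    rewrite sYF sXY andbT /=; apply/eqP.
    have prX : X \proper Y by rewrite properEcard sXY oX.
    have prY : Y \proper F by rewrite properEcard sYF oF.
    by rewrite (psection_mid_card p_pr (secX X XB) prX prY) oX.
  by rewrite sXY sYF oY /= -{1}(expn1 p) !ltn_exp2l.
rewrite /tilde (eq_bigr _ fX) sumrB sumr_const (card_between p_pr secD).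
rewrite (exchange_big_dep (mem (rank2 F))) /=; last by move=> X Y _ /andP[].
rewrite (bigD1 D) //= [in RHS](bigD1 D) //=.
have -> : \sum_(X in between 1%G D | (D \in rank2 F) && (X \subset D)) f D =
  f D *+ p.+1.
  rewrite -(card_between p_pr secD) -sumr_const; apply: eq_bigl => X.
  by rewrite D2 andb_idr // => /sXD.
have -> : \sum_(Y in rank2 F | Y != D)
      \sum_(X in between 1%G D | (Y \in rank2 F) && (X \subset Y)) f Y
    = \sum_(Y in rank2 F | Y != D) f Y.
  apply: eq_bigr => Y /andP[Y2 neYD].
  rewrite (big_pred1 (D :&: Y)%G) // => X.
  rewrite Y2 /=; have [sYF oY] : Y \subset F /\ #|Y| = (p ^ 2)%N.
    by move: Y2; rewrite inE => /andP[-> /eqP->].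
  have prDY : D :&: Y \proper D.
    rewrite properE subsetIl; apply: contra neYD => sDY.
    by apply/eqP/group_inj/esym/eqP;
      rewrite eqEcard oD oY leqnn (subset_trans sDY) ?subsetIr.
  have ntDY : D :&: Y != 1%g.
    apply/eqP => tiDY; have := subset_leq_card (mul_subG sDF sYF).
    by rewrite (TI_cardMg tiDY) oD oY oF -expnD leq_exp2l.
  have IB : (D :&: Y)%G \in between 1%G D by rewrite inE prDY proper1G ntDY.
  apply/andP/eqP => [[XB sXY]|->]; last by rewrite IB subsetIr.
  apply/group_inj/eqP; rewrite eqEcard subsetI (sXD X XB) sXY /=.
  by rewrite (oX X XB) (oX _ IB).
rewrite -[f D *+ _]mulr_natr -[(p%:Z * _) *+ _]mulr_natr.
rewrite (_ : p.+1%:R = p%:Z + 1); last by rewrite -addn1 natrD natz.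
move: (p%:Z) (f D) (f F) (\sum_(Y in _ | _) _) => q a b c; ring.
Qed.

(** If D1 and D2 are distinct, they generate an elementary abelian group of
    order p^3. *)
Lemma tilde_meet f E D1 D2 : nontrivial_relations p f -> E \subset P ->
  p.-abelem E ->
  D1 \in rank2 E -> D2 \in rank2 E -> D1 :&: D2 != 1%g -> tilde f D1 = tilde f D2.
Proof.
move=> rel sEP abE; rewrite !inE => /andP[sD1 /eqP o1] /andP[sD2 /eqP o2] nt.
have [->//|ne] := eqVneq D1 D2.
have pr12 : D1 :&: D2 \proper D1.
  rewrite properE subsetIl; apply: contra ne => s12.
  by apply/eqP/group_inj/eqP;
    rewrite eqEcard o1 o2 leqnn (subset_trans s12) ?subsetIr.
have sec : psection p 1%G D1.
  by apply: abelem_psection; rewrite ?sub1G ?o1 ?cards1 ?muln1 // (abelemS sD1).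
have oI : #|D1 :&: D2| = p.
  by rewrite (psection_mid_card p_pr sec (X :=
    (D1 :&: D2)%G)) ?proper1G // cards1 muln1.
have cD : D1 \subset 'C(D2) by rewrite (sub_abelian_cent2 (abelem_abelian abE)).
have sF : D1 <*> D2 \subset E by rewrite join_subG sD1.
have oF : #|D1 <*> D2| = (p ^ 3)%N.
  apply/eqP; rewrite /= cent_joinEl // -(eqn_pmul2r (prime_gt0 p_pr)) -{1}oI
    -mul_cardG o1 o2.
  by rewrite -expnD -expnSr.
have := @tilde_rank3 f (D1 <*> D2)%G _ rel (subset_trans sF sEP) (abelemS sF abE)
  oF.
by move=> e; rewrite !e // inE ?joing_subl ?joing_subr ?o1 ?o2 /=.
Qed.

(** If D1 and D2 meet trivially, the group generated by a nontrivial element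
    of each meets both. *)
Lemma tilde_const f E D1 D2 : nontrivial_relations p f -> E \subset P ->
  p.-abelem E ->
  D1 \in rank2 E -> D2 \in rank2 E -> tilde f D1 = tilde f D2.
Proof.
move=> rel sEP abE D1E D2E.
have [ti|nt] := eqVneq (D1 :&: D2) 1%g; last exact: (tilde_meet rel sEP abE).
have [[s1 o1] [s2 o2]] : (D1 \subset E /\ #|D1| =
  p ^ 2)%N /\ (D2 \subset E /\ #|D2| = p ^ 2)%N.
  by move: D1E D2E; rewrite !inE => /andP[-> /eqP->] /andP[-> /eqP->].
have nt D : #|D| = (p ^ 2)%N -> exists2 x, x \in D & x != 1%g.
  move=> oD; have /trivgPn[x Dx nx] : D :!=: 1%g.
    by rewrite -cardG_gt1 oD -(exp1n 2) ltn_exp2r ?prime_gt1.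
  by exists x.
have [x Dx nx] := nt _ o1; have [y Dy ny] := nt _ o2.
have Ex := subsetP s1 x Dx; have Ey := subsetP s2 y Dy.
have D3 : (<[x]> <*> <[y]>)%G \in rank2 E.
  rewrite inE join_subG !cycle_subG Ex Ey /= (abelem_extend (E :=
    E) p_pr) ?cycle_subG //.
    by rewrite (abelem_cycle abE Ex nx).
  apply/negP=> xy; have : y \in D1 :&: D2.
    by rewrite inE Dy andbT; apply: subsetP xy; rewrite cycle_subG.
  by rewrite ti => /set1P y1; rewrite y1 eqxx in ny.
have meet D z : z \in D -> z \in <[x]> <*> <[y]> -> z != 1%g ->
  D :&: (<[x]> <*> <[y]>) != 1%g.
  move=> Dz xyz; apply: contraNneq => e; have : z \in D :&: (<[x]> <*> <[y]>).
    by rewrite inE Dz.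
  by rewrite e => /set1P->.
rewrite (tilde_meet rel sEP abE D1E D3).
  apply: (tilde_meet rel sEP abE D3 D2E); rewrite setIC; apply: meet Dy _ ny.
  by rewrite mem_gen // inE cycle_id orbT.
by apply: meet Dx _ nx; rewrite mem_gen // inE cycle_id.
Qed.

End Tilde.

(** * A normal subgroup that separates the components *)

Section Pivot.

Variables (p : nat) (gT : finGroupType) (P : {group gT}).
Hypotheses (p_pr : prime p) (pP : p.-group P).
Implicit Types D E F S T X Y Z U : {group gT}.

(** The subgroup U singles out one component of the poset at most. If U is
    elementary abelian, the groups that centralise U are in the component of
    U; if P has no such normal subgroup, U is cyclic of order 4 and no
    elementary abelian group of order 4 centralises it. *)
Definition pivot Z U :=
  [/\ Z \subset 'Z(P) /\ #|Z| = p, Z \subset U /\ U \subset P, #|U| = (p ^ 2)%N,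
      [~: U, P] \subset Z
    & U \in 'E_p^2(P) \/ forall E, E \in 'E_p^2(P) -> ~~ (E \subset 'C(U))].

Lemma pivot_exists : (1 < 'r(P))%N -> exists Z U, pivot Z U.
Proof.
move=> rP; have p_gt0 := prime_gt0 p_pr.
have prU (U Z : {group gT}) : #|U| = (p ^ 2)%N -> #|Z| = p -> Z \subset U ->
  prime #|U : Z|.
  by move=> oU oZ sZU; rewrite -divgS // oU oZ expnS expn1 mulnK.
have [[E nE pE]|cP|[p2 [A [U cAU]]]] := pgroup_trichotomy p_pr pP.
- have [sEP abE oE] := pnElemPcard pE.
  have ntE : E :!=: 1%g by apply: (nt_pnElem pE).
  have ntI := meet_center_nil (pgroup_nil pP) nE ntE.
  have pI : p.-group (E :&: 'Z(P)) by apply: pgroupS pP; apply: subIset;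
    rewrite sEP.
  have [_ /(Cauchy p_pr)[z Iz oz] _] := pgroup_pdiv pI ntI.
  have [Ez Zz] := setIP Iz.
  have sZZ : <[z]> \subset 'Z(P) by rewrite cycle_subG.
  have sZE : <[z]> \subset E by rewrite cycle_subG.
  exists <[z]>%G, E; split=> //; last by left.
  by apply: (central_chief pP sZZ sZE nE); apply: prU.
- by move: rP; rewrite ltnNge -(abelian_rank1_cyclic (cyclic_abelian cP)) cP.
have ntP : P :!=: 1%g by apply: contraTneq rP => ->; rewrite rank1.
have [Z sZZ oZ] := central_prime_subgroup p_pr pP ntP.
have pP2 : 2.-group P by rewrite -{1}p2.
have oZ2 : #|Z| = 2%N by rewrite oZ.
have [sZU nUP _] := cyclic_cent4_center pP2 cAU sZZ oZ2.
have [[cA sAP] iA sUA oU cUA] := cAU.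
have oUp : #|U| = (p ^ 2)%N by rewrite oU p2.
exists Z, U; split=> //; first by rewrite (subset_trans sUA).
  by apply: (central_chief pP sZZ sZU nUP); apply: prU.
right=> E pE; have [sEP abE oE] := pnElemPcard pE.
apply/negP=> cEU; have sEA : E \subset A by rewrite -cUA subsetI sEP.
by have := cyclicS sEA cA; rewrite (abelem_cyclic abE) oE pfactorK.
Qed.

Section WithPivot.

Variables Z U : {group gT}.
Hypothesis piv : pivot Z U.

Let sZZ : Z \subset 'Z(P). Proof. by have [[]] := piv. Qed.
Let oZ : #|Z| = p. Proof. by have [[]] := piv. Qed.
Let sZU : Z \subset U. Proof. by have [_ []] := piv. Qed.
Let sUP : U \subset P. Proof. by have [_ []] := piv. Qed.
Let oU : #|U| = (p ^ 2)%N. Proof. by have [] := piv. Qed.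
Let cUP : [~: U, P] \subset Z. Proof. by have [] := piv. Qed.
Let sZP : Z \subset P. Proof. exact: subset_trans sZZ (center_sub P). Qed.
Let cZP : P \subset 'C(Z).
Proof. by rewrite centsC; apply: subset_trans sZZ (subsetIr _ _). Qed.
Let prZ : prime #|Z|. Proof. by rewrite oZ. Qed.
Let abZ : p.-abelem Z.
Proof.
by rewrite abelemE // cyclic_abelian ?prime_cyclic //= -oZ exponent_dvdn.
Qed.

Let memE D : D \in 'E_p^2(P) -> [/\ D \subset P, p.-abelem D & #|D| = (p ^ 2)%N].
Proof. exact: pnElemPcard. Qed.

(** The element g permutes transitively the p subgroups <[x z]> of order p
    of D other than Z, so f is constant on them and their contribution to
    the sum is divisible by p. *)
Lemma tilde_mod (f : superclass P) D x g : D \in 'E_p^2(P) -> Z \subset D ->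
  x \in D ->
  g \in P -> [~ x, g]%g \in Z -> [~ x, g]%g != 1%g ->
  exists m, tilde p f D = f Z + p%:Z * m.
Proof.
move=> pD sZD Dx Pg Zc nc; have sec := p2Elem_psection pD.
have [sDP abD oD] := memE pD; have cgZ : g \in 'C(Z) by apply: (subsetP cZP).
have nZx : x \notin Z.
  apply: contra nc => Zx; apply/commgP/esym.
  by apply: (centP cgZ).
have ord z : z \in Z -> #|<[x * z]>| = p.
  move=> Zz; apply: (abelem_cycle abD); first by rewrite groupM // (subsetP sZD).
  by apply: contra nZx => /eqP e; rewrite -(mulgK z x) e mul1g groupV.
pose h z := <[x * z]>%G.
have hB z : z \in Z -> h z \in between 1%G D :\ Z.
  move=> Zz; have Dxz : (x * z)%g \in D by rewrite groupM // (subsetP sZD).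
  rewrite !inE proper1G -cardG_gt1 ord // prime_gt1 // properEcard cycle_subG Dxz
    ord // oD.
  rewrite -{1}(expn1 p) ltn_exp2l ?prime_gt1 // !andbT.
  apply: contra nZx => /eqP/(congr1 val)/= e.
  by rewrite -(groupMr x Zz) -e cycle_id.
have hinj : {in Z &, injective h}.
  move=> z z' Zz Zz' /(congr1 val) e0.
  have {e0}e : <[(x * z)%g]> = <[(x * z')%g]> :> {set gT} := e0; apply/eqP;
    rewrite eq_mulVg1.
  apply/negPn/negP=> ne; have Zw : (z^-1 * z')%g \in Z by rewrite groupM ?groupV.
  have hw : (z^-1 * z')%g \in <[x * z]>.
    have -> : (z^-1 * z' = (x * z)^-1 * (x * z'))%g by rewrite invMg -!mulgA mulKg.
    by apply: groupM; [rewrite groupV cycle_id | rewrite /= e cycle_id].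
  have eZ : Z :=: <[z^-1 * z']>.
    apply/esym/eqP; rewrite eqEcard cycle_subG Zw oZ (abelem_cycle abZ) //=.
  have /setD1P[/eqP neZ _] := hB z Zz; case: neZ; apply: group_inj.
  by apply/esym/eqP; rewrite eqEcard /= ord // oZ leqnn andbT eZ cycle_subG.
have ZB : Z \in between 1%G D.
  rewrite inE proper1G -cardG_gt1 oZ prime_gt1 // properEcard sZD oZ oD.
  by rewrite -{1}(expn1 p) ltn_exp2l ?prime_gt1.
have imh : [set h z | z in Z] = between 1%G D :\ Z.
  apply/eqP; rewrite eqEcard; apply/andP; split.
    by apply/subsetP=> _ /imsetP[z Zz ->]; apply: hB.
  have := cardsD1 Z (between 1%G D);
    rewrite (card_between p_pr sec) ZB add1n => -[<-].
  by rewrite card_in_imset // oZ.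
have fh z : z \in Z -> f (h z) = f <[x]>%G.
  move=> Zz; have [i e] := conjg_coset_prime prZ cgZ Zc nc Zz.
  rewrite -(superclass_conj f <[x]>%G (groupX i Pg)); congr (f _).
  by apply: group_inj; rewrite /= -cycleJ e.
exists (f <[x]>%G - f D); rewrite /tilde (big_setD1 Z) //= -imh big_imset //=.
rewrite (eq_bigr (fun=> f <[x]>%G)) // sumr_const oZ -[f _ *+ p]mulr_natl natz.
by move: (p%:Z) => q; ring.
Qed.

(** Some u in U does not centralise E, and it normalises E because [U, P] <=
    Z <= E. *)
Lemma tilde_mod_noncentralising (f : superclass P) E : E \in 'E_p^2(P) ->
  Z \subset E ->
  ~~ (E \subset 'C(U)) -> exists m, tilde p f E = f Z + p%:Z * m.
Proof.
move=> pE sZE /subsetPn[x Ex /not_cent_commg[u Uu nu]].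
have [sEP _ _] := memE pE.
apply: (tilde_mod f pE sZE Ex (subsetP sUP u Uu) _ nu).
by rewrite -invg_comm groupV (subsetP cUP) // mem_commg // (subsetP sEP).
Qed.

Lemma tilde_mod_pivot (f : superclass P) : U \in 'E_p^2(P) ->
  ~~ (U \subset 'Z(P)) ->
  exists m, tilde p f U = f Z + p%:Z * m.
Proof.
move=> pU; rewrite subsetI sUP /= => /subsetPn[x Ux /not_cent_commg[g Pg ng]].
by apply: (tilde_mod f pU sZU Ux Pg _ ng); rewrite (subsetP cUP) // mem_commg.
Qed.

(** Every component contains a group of order p^2 that contains the central
    subgroup Z: take it inside D Z. *)
Lemma p2Elem_with_center D : D \in 'E_p^2(P) -> exists D' F,
  [/\ D' \in 'E_p^2(P), Z \subset D', p.-abelem F /\ F \subset P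
    & D \in rank2 p F /\ D' \in rank2 p F].
Proof.
move=> pD; have [sDP abD oD] := memE pD.
have cDZ : D \subset 'C(Z) by apply: subset_trans cZP.
have abF : p.-abelem (D <*> Z) by apply: abelem_joing.
have sFP : D <*> Z \subset P by rewrite join_subG sDP.
have [y Dy nZy] : exists2 y, y \in D & y \notin Z.
  apply/subsetPn/negP=> /subset_leq_card.
  by rewrite oD oZ leqNgt -{1}(expn1 p) ltn_exp2l ?prime_gt1.
have Fy : y \in D <*> Z by rewrite mem_gen // inE Dy.
have sD'F : Z <*> <[y]> \subset D <*> Z by rewrite join_subG joing_subr cycle_subG.
have oD' : #|Z <*> <[y]>| = (p ^ 2)%N.
  by rewrite (abelem_extend p_pr abF) ?joing_subr // oZ.
exists (Z <*> <[y]>)%G, (D <*> Z)%G; split=> //.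
- by apply: p2Elem_card; rewrite ?(subset_trans sD'F) // (abelemS sD'F).
- exact: joing_subl.
by rewrite !inE joing_subl oD sD'F /= [#|_|]oD' !eqxx.
Qed.

Lemma p2Elem_centralising_pivot E : E \in 'E_p^2(P) -> E \subset 'C(U) ->
  [/\ U \in 'E_p^2(P), p.-abelem (E <*> U), E <*> U \subset P,
      E \in rank2 p (E <*> U)%G & U \in rank2 p (E <*> U)%G].
Proof.
move=> pE cEU; have [sEP abE oE] := memE pE.
have pU : U \in 'E_p^2(P).
  by have [_ _ _ _ [//|no]] := piv; have := no E pE; rewrite cEU.
have [_ abU _] := memE pU.
split=> //; first exact: abelem_joing.
- by rewrite join_subG sEP.
- by rewrite inE joing_subl oE /=.
by rewrite inE joing_subr oU /=.
Qed.

(** Suppose that X does not centralise U, say [x, u] <> 1 with x in X. The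
    conjugates of u under T lie in u Z, so D = 'C_T(u), which is 'C_T(U),
    has index p in T and meets X trivially. As T^p <= X, D has exponent p. *)
Lemma section_centralising T X : T \subset P -> #|X| = p -> psection p X T ->
  [/\ X \subset 'C(T) & X \subset 'C(U) \/
     exists2 D, D \in 'E_p^2(P) & D \subset 'C(U) /\ D \subset T].
Proof.
move=> sTP oX sec; have [nXT iXT eT] := sec; have sXT := normal_sub nXT.
have prX : prime #|X| by rewrite oX.
have ntX : X :!=: 1%g by rewrite -cardG_gt1 oX prime_gt1.
have pT := pgroupS sTP pP.
have cXT : X \subset 'C(T).
  have nt := meet_center_nil (pgroup_nil pT) nXT ntX.
  suff : X \subset 'Z(T) by rewrite subsetI => /andP[].
  by apply: contraR nt => /(prime_TIg prX)/eqP.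
split=> //; have [cXU|/subsetPn[x Xx /not_cent_commg[u Uu ncu]]] :=
  boolP (X \subset 'C(U)).
  by left.
right.
have Pu := subsetP sUP u Uu; have Tx := subsetP sXT x Xx; have Px :=
  subsetP sTP x Tx.
have nZu : u \notin Z.
  apply: contra ncu => Zu; apply/commgP.
  by have /centP := subsetP cZP x Px; apply.
(* As |U : Z| = p, centralising U amounts to centralising u. *)
have defU : U :=: Z <*> <[u]>.
  have sZu : Z <*> <[u]> \subset U by rewrite join_subG sZU cycle_subG.
  apply/esym/eqP; rewrite eqEcard sZu oU /=.
  have /(dvdn_pfactor _ _ p_pr)[k k2 ek] : (#|Z <*> <[u]>| %| p ^ 2)%N by rewrite
    -oU cardSg.
  have : (#|Z| < #|Z <*> <[u]>|)%N.
    apply: proper_card; rewrite properE joing_subl join_subG subxx /= cycle_subG //.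
  rewrite [in X in X -> _]ek oZ -{1}(expn1 p) (ltn_exp2l _ _ (prime_gt1 p_pr)) =>
    k1.
  by rewrite [X in (_ <= X)%N]ek (leq_exp2l _ _ (prime_gt1 p_pr)).
pose D := 'C_T[u]%G.
have cDU : D \subset 'C(U).
  rewrite defU centY cent_cycle subsetI [X in _ && X]subsetIr andbT.
  by apply: subset_trans cZP; apply: subset_trans sTP; apply: subsetIl.
have tiXD : X :&: D = 1%g.
  apply: prime_TIg => //; apply: contra ncu => sXD.
  by apply/commgP; have /setIP[_ /cent1P] := subsetP sXD x Xx; apply.
have oT : #|T| = (p ^ 2 * p)%N by rewrite (psection_card sec) oX.
have oD : (p ^ 2 <= #|D|)%N.
  have iD : (#|T : D| <= p)%N.
    rewrite -/(D : {set gT}) index_cent1 -oZ -(card_lcoset Z u);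
      apply: subset_leq_card.
    apply/subsetP=> _ /imsetP[t Tt ->]; rewrite conjg_mulR mem_lcoset mulKg.
    by rewrite (subsetP cUP) // mem_commg // (subsetP sTP).
  rewrite -(leq_pmul2r (prime_gt0 p_pr)) -oT -(Lagrange (subsetIl T 'C[u])).
  by rewrite leq_mul2l iD orbT.
have oD2 : #|D| = (p ^ 2)%N.
  apply/eqP; rewrite eqn_leq oD andbT -(leq_pmul2r (prime_gt0 p_pr)) -oT -oX mulnC.
  rewrite -(TI_cardMg tiXD); apply: subset_leq_card; rewrite mul_subG ?subsetIl //.
have sDT : D \subset T by apply: subsetIl.
have sDP := subset_trans sDT sTP.
exists D => //; apply: (p2Elem_card p_pr) => //; apply/(abelemP p_pr); split.
  apply: card_p2group_abelian p_pr _ => //.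
move=> d Dd; have : (d ^+ p)%g \in X :&: D.
  by rewrite in_setI (groupX p Dd) andbT; apply/eT/(subsetP sDT).
by rewrite tiXD => /set1P.
Qed.

End WithPivot.
End Pivot.

(** * Locally constant functions *)

Section Obstruction.

Variables (p : nat) (gT : finGroupType) (P : {group gT}).
Hypotheses (p_pr : prime p) (pP : p.-group P).
Implicit Types D E F S T X Y Z U : {group gT}.
Implicit Types (f h : superclass P) (g : gT) (s t : gluing P) (phi : locconst p P).

Lemma rank2_p2Elem D E : E \subset P -> p.-abelem E -> D \in rank2 p E ->
  D \in 'E_p^2(P).
Proof.
rewrite inE => sEP abE /andP[sDE /eqP oD].
by apply: (p2Elem_card p_pr); rewrite ?(subset_trans sDE) ?(abelemS sDE).
Qed.

Lemma p2Elem_rank2 D : D \in 'E_p^2(P) -> D \in rank2 p D.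
Proof. by case/pnElemPcard=> _ _ oD; rewrite inE oD subxx /=. Qed.

Lemma abelem2_spec (E : abelem2 p P) :
  [/\ E \subset P, p.-abelem E & exists D, D \in rank2 p E].
Proof.
have /andP[/pElemP[sEP abE] rE] := abelem2P E; split=> //.
have [|D [sDE _ oD]] := normal_pgroup (abelem_pgroup abE) (normal_refl E) (r := 2).
  by rewrite -(rank_abelem abE).
by exists D; rewrite inE sDE oD /=.
Qed.

Lemma abelem2_intro D E : E \subset P -> p.-abelem E -> D \in rank2 p E ->
  (E \in 'E_p(P)) && (1 < 'r(E))%N.
Proof.
rewrite inE => sEP abE /andP[sDE /eqP oD]; rewrite (rank_abelem abE).
rewrite (introT pElemP) //= -(pfactorK 2 p_pr) -oD dvdn_leq_log ?cardG_gt0 //.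
exact: cardSg.
Qed.

(** Reading a locally constant function at arbitrary subgroups avoids
    carrying the proofs that they are elementary abelian of rank at least 2. *)
Definition group_val phi E : int :=
  if insub E is Some e then phi (e : abelem2 p P) else 0.

Lemma group_valE phi (e : abelem2 p P) : group_val phi e = phi e.
Proof. by rewrite /group_val valK. Qed.

Lemma locconst_conj phi (E F : abelem2 p P) g : g \in P -> F :=: (E :^ g)%g ->
  phi F = phi E.
Proof.
move=> Pg eF; have /'forall_forallP/(_ E F)/andP[/implyP+ _] := locconstP phi.
by move=> eJ; apply/eqP/eJ/exists_inP; exists g; rewrite ?eF.
Qed.

Lemma locconst_sub phi (E F : abelem2 p P) : E \subset F -> phi E = phi F.
Proof.
move=> sEF; have /'forall_forallP/(_ E F)/andP[_ /implyP/(_ sEF)/eqP] :=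
  locconstP phi.
by [].
Qed.

Lemma group_val_sub phi D E : E \subset P -> p.-abelem E -> D \in rank2 p E ->
  group_val phi D = group_val phi E.
Proof.
move=> sEP abE DE; have aE := abelem2_intro sEP abE DE.
have pD := rank2_p2Elem sEP abE DE; have [sDP abD _] := pnElemPcard pD.
have aD := abelem2_intro sDP abD (p2Elem_rank2 pD).
rewrite -[D]/(Abelem2 aD : {group gT}) -[E]/(Abelem2 aE : {group gT}) !group_valE.
by apply: locconst_sub; move: DE; rewrite inE => /andP[].
Qed.

Lemma group_valJ phi E g : g \in P -> group_val phi (E :^ g)%G = group_val phi E.
Proof.
move=> Pg.
(* A group and its conjugate are elementary abelian of rank at least 2
   together, so both values are 0 if they are not. *)
have aJ : ((E :^ g)%G \in 'E_p(P)) && (1 < 'r(E :^ g))%N = (E \in 'E_p(P)) &&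
  (1 < 'r(E))%N.
  by rewrite rankJ !inE /= abelemJ -{1}(conjGid Pg) conjSg.
have [aE|naE] := boolP ((E \in 'E_p(P)) && (1 < 'r(E))%N); last first.
  by rewrite /group_val !insubF ?aJ // (negPf naE).
have aEg : ((E :^ g)%G \in 'E_p(P)) && (1 < 'r(E :^ g))%N by rewrite aJ.
rewrite -[E in RHS]/(Abelem2 aE : {group gT}) -[(E :^ g)%G]/(Abelem2 aEg : {group
  gT}).
by rewrite !group_valE; apply: (locconst_conj _ Pg).
Qed.

(** The choice of a subgroup of order p^2 depends only on the group and not
    on the function, which makes the obstruction map additive. *)
Definition rank2_choice E : {group gT} := odflt E [pick D in rank2 p E].

Lemma rank2_choiceP (E : abelem2 p P) : rank2_choice E \in rank2 p E.
Proof.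
have [_ _ [D DE]] := abelem2_spec E.
by rewrite /rank2_choice; case: pickP => [//|/(_ D)]; rewrite DE.
Qed.

Lemma rank2_choice_p2Elem (E : abelem2 p P) : rank2_choice E \in 'E_p^2(P).
Proof. by have [sEP abE _] := abelem2_spec E;
  apply: rank2_p2Elem (rank2_choiceP E). Qed.

Definition tilde_fun f : {ffun abelem2 p P -> int} :=
  [ffun E : abelem2 p P => tilde p f (rank2_choice E)].

Lemma tilde_fun_locconst f : nontrivial_relations p f ->
  tilde_fun f \in @is_locconst p gT P.
Proof.
move=> rel; apply/'forall_forallP=> E F; have [sFP abF _] := abelem2_spec F.
rewrite !ffunE; apply/andP; split; apply/implyP.
  case/exists_inP=> g Pg /eqP eF;
    rewrite -[tilde p f (rank2_choice E)](tildeJ p f _ Pg); apply/eqP.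
  apply: (tilde_const p_pr rel sFP abF (rank2_choiceP F)).
  by move: (rank2_choiceP E); rewrite !inE /= eF conjSg cardJg.
move=> sEF; apply/eqP/(tilde_const p_pr rel sFP abF); last exact: rank2_choiceP.
by move: (rank2_choiceP E); rewrite !inE => /andP[/subset_trans-> //].
Qed.

Definition tilde_locconst f (rel : nontrivial_relations p f) :=
  LocConst (tilde_fun_locconst rel).

Lemma tilde_locconstP f (rel : nontrivial_relations p f) : is_tilde f
  (tilde_locconst rel).
Proof.
split=> [E oE|E F oE ltF sEF]; rewrite /= !ffunE.
  have -> : rank2_choice E = E.
    have := rank2_choiceP E; rewrite inE => /andP[sbE /eqP ob].
    by apply/group_inj/eqP; rewrite eqEcard sbE oE ob leqnn.
  by congr (_ - _); apply: eq_bigl => X; rewrite inE proper1G.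
have [sFP abF _] := abelem2_spec F.
apply: (tilde_const p_pr rel sFP abF (rank2_choiceP F)).
by move: (rank2_choiceP E); rewrite !inE => /andP[/subset_trans-> //].
Qed.

Lemma eq_tilde f h D : (forall L : {group gT}, L :!=: 1%g -> f L =
  h L) -> D :!=: 1%g ->
  tilde p f D = tilde p h D.
Proof.
move=> fh ntD; rewrite /tilde fh //; congr (_ - _); apply: eq_bigr => X.
by rewrite inE proper1G => /andP[ntX _]; apply: fh.
Qed.

Lemma tilde_funB f h E : tilde p (f - h) E = tilde p f E - tilde p h E.
Proof.
rewrite /tilde /= !ffunE mulrDr mulrN.
rewrite (eq_bigr (fun X => f X - h X)) => [|X _]; last by rewrite !ffunE.
by rewrite sumrB; ring.
Qed.

End Obstruction.

(** * The exact sequence *)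

Section ExactSequence.

Variables (p : nat) (gT : finGroupType) (P : {group gT}).
Hypotheses (p_pr : prime p) (pP : p.-group P) (rP : (1 < 'r(P))%N).
Implicit Types D E F S T X Y Z U : {group gT}.
Implicit Types (f h : superclass P) (g : gT) (s t : gluing P) (phi : locconst p P).

Lemma redH0_class_eq0 phi : redH0_class phi = 0 <-> exists c,
  forall E : abelem2 p P, phi E = c.
Proof.
rewrite /redH0_class -[X in _ = X](raddf0 (\pi_(redH0 p P))%qT).
split=> [/eqP|cst].
  by rewrite -Quotient.idealrBE subr0 => /asboolP.
by apply/eqP; rewrite -Quotient.idealrBE subr0; apply/asboolP.
Qed.

Fact const_locconst (c : int) : [ffun=> c] \in @is_locconst p gT P.
Proof. by apply/'forall_forallP=> E F; rewrite !ffunE eqxx !implybT. Qed.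

Definition const_loc c := LocConst (const_locconst c).

Lemma redH0_class_const phi c : redH0_class (phi - const_loc c) = redH0_class phi.
Proof.
rewrite /redH0_class raddfB [X in _ - X](_ : _ = 0) ?subr0 //.
by apply/redH0_class_eq0; exists c => E; rewrite ffunE.
Qed.

(** Move to a subgroup D' of order p^2 that contains Z. If D' does not
    centralise U, the value is f Z modulo p. If it does, U is elementary
    abelian and the value is that of U, which is again f Z modulo p unless U
    is central; but then every D' centralises U. So one constant c serves
    all components. *)
Lemma tilde_mod_p f : nontrivial_relations p f ->
  exists c, forall E : abelem2 p P, (p %| tilde_fun p f E - c)%Z.
Proof.
move=> rel; have [Z [U piv]] := pivot_exists p_pr pP rP.
have dvdm (a b : int) : (exists m, a = b + p%:Z * m) -> (p %| a - b)%Z.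
  by case=> m ->; rewrite addrAC subrr add0r dvdz_mulr.
pose c := if U \subset 'Z(P) then tilde p f U else f Z.
exists c => E; rewrite ffunE; have pD := rank2_choice_p2Elem p_pr E.
have [D' [F [pD' sZD' [abF sFP] [DF D'F]]]] := p2Elem_with_center p_pr piv pD.
rewrite (tilde_const p_pr rel sFP abF DF D'F).
have [cDU|ncDU] := boolP (D' \subset 'C(U)).
  have [pU abG sGP D'G UG] := p2Elem_centralising_pivot p_pr piv pD' cDU.
  rewrite (tilde_const p_pr rel sGP abG D'G UG) /c.
  case: ifPn => [_|nUZ]; first by rewrite subrr dvdz0.
  exact/dvdm/(tilde_mod_pivot p_pr piv).
have nUZ : U \subset 'Z(P) = false.
  apply/negbTE; apply: contra ncDU; rewrite subsetI => /andP[_].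
  by rewrite centsC; apply: subset_trans; case/pnElemPcard: pD'.
by rewrite /c nUZ; apply/dvdm/(tilde_mod_noncentralising p_pr piv).
Qed.

Lemma tilde_redH0p f (rel : nontrivial_relations p f) :
  redH0_class (tilde_locconst p_pr rel) \in @is_redH0p p gT P.
Proof.
have [c dv] := tilde_mod_p rel; apply/asboolP.
exists (tilde_locconst p_pr rel - const_loc c); last by rewrite redH0_class_const.
by move=> E; have := dv E; rewrite !ffunE.
Qed.

Lemma p2Elem_exists : exists2 E, E \in 'E_p^2(P) & E :!=: 1%g.
Proof.
have /p_rank_geP[E pE] : (1 < 'r_p(P))%N by rewrite -(rank_pgroup pP).
by exists E => //; apply: (nt_pnElem pE).
Qed.

Lemma ratclass_relations (f : ratclass P) : nontrivial_relations p f.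
Proof. by move=> S T _ sTP; apply: ratclass_section => //; apply: ratclassP. Qed.

(** Rational class functions that agree on nontrivial subgroups agree at the
    trivial one, by the relation for an elementary abelian subgroup of order
    p^2, which exists because P has rank at least 2. *)
Lemma gluing_restriction : exists2 r : {additive ratclass P -> gluing P},
  is_rmap r & injective r.
Proof.
have /choice[r rP'] : forall f : ratclass P, exists s, is_solution s f.
  by move=> f; apply: (relations_gluing p_pr pP); apply: ratclass_relations.
have rB : zmod_morphism r.
  by move=> f h; apply: (solution_inj (rP' (f - h))); apply: solutionB.
pose rM := GRing.isZmodMorphism.Build _ _ r rB.
pose rA : {additive ratclass P -> gluing P} := HB.pack r rM.
exists rA => // f h /= e; apply/val_inj/val_inj/ffunP=> L /=.
have fh (L' : {group gT}) : L' :!=: 1%g -> f L' = h L'.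
  by apply: (solution_unique (rP' f)); rewrite e.
have [L1|ntL] := eqVneq (L : {set gT}) 1%g; last exact: fh.
have -> : L = 1%G by apply: group_inj.
have [E pE ntE] := p2Elem_exists; have [sEP _ _] := pnElemPcard pE.
have sec := p2Elem_psection pE.
have := ratclass_section p_pr (ratclassP f) sEP sec.
have := ratclass_section p_pr (ratclassP h) sEP sec.
rewrite /section_relation => eh ef.
apply: (@addIr _ (p%:Z * h E)); rewrite [RHS]eh -(fh E ntE) [LHS]ef;
  apply: eq_bigr => X.
by rewrite inE proper1G => /andP[ntX _]; rewrite fh.
Qed.

(** The class is computed with the solution that vanishes at the trivial
    subgroup; by solution_unique the value at the trivial subgroup is the
    only ambiguity, and the function of the solution does not involve it. *)
Definition obstruction s : redH0p p P :=
  RedH0p (tilde_redH0p (solution_relations p_pr (solutionP s 0))).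

Lemma obstruction_tilde s f (E : abelem2 p P) : is_solution s f ->
  tilde_locconst p_pr (solution_relations p_pr (solutionP s 0)) E =
    tilde p f (rank2_choice p E).
Proof.
move=> sf; rewrite /= ffunE; apply: eq_tilde => [L ntL|].
  exact: (solution_unique (solutionP s 0) sf).
exact: (nt_pnElem (rank2_choice_p2Elem p_pr E)).
Qed.

Lemma obstruction_zmod : zmod_morphism obstruction.
Proof.
move=> s t; apply: val_inj; rewrite raddfB /= -raddfB; congr (redH0_class _).
apply/val_inj/ffunP=> E.
have st := solutionB (solutionP s 0) (solutionP t 0).
have := obstruction_tilde E st; rewrite tilde_funB.
rewrite -(obstruction_tilde E (solutionP s 0)) -(obstruction_tilde E (solutionP t
  0)) => e.
by apply: etrans e _; rewrite /= !ffunE.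
Qed.

(** The function of a solution is constant with value c if and only if the
    solution with value c at the trivial subgroup also satisfies the
    relations of the sections T / 1, that is, if and only if this solution
    is a rational class function. *)
Lemma obstruction_eq0 s : obstruction s = 0 <-> exists f : ratclass P,
  is_solution s f.
Proof.
split=> [e0|[f sf]]; last first.
  apply/val_inj/redH0_class_eq0; exists (f 1%G) => E.
  rewrite (obstruction_tilde E sf); have pE := rank2_choice_p2Elem p_pr E.
  have [sEP _ _] := pnElemPcard pE.
  have := ratclass_section p_pr (ratclassP f) sEP (p2Elem_psection pE).
  by rewrite /tilde /section_relation => <-; rewrite addrK.
have /redH0_class_eq0[c cE] := congr1 val e0.
pose f := solution s c; have sf : is_solution s f := solutionP s c.
have rel := solution_relations p_pr sf.
have rat : f \in @is_ratclass gT P.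
  apply: (section_ratclass p_pr pP) => S T sTP sec.
  have [S1|ntS] := eqVneq (S : {set gT}) 1%g; last exact: rel.
  have eS : S = 1%G by apply: group_inj.
  rewrite {}eS {S1} in sec *; have oT := psection_card sec;
    rewrite cards1 muln1 in oT.
  have abT : p.-abelem T.
    have [_ _ eT] := sec; apply/(abelemP p_pr); split.
      by apply: card_p2group_abelian p_pr _.
    by move=> t Tt; apply/set1P/eT.
  have aT := abelem2_intro p_pr sTP abT (p2Elem_rank2 (p2Elem_card p_pr sTP abT
    oT)).
  have := cE (Abelem2 aT); rewrite (obstruction_tilde _ sf).
  have [sbE /eqP ob] : rank2_choice p (Abelem2 aT) \subset T /\ #|rank2_choice p
    (Abelem2 aT)| == (p ^ 2)%N.
    by have := rank2_choiceP (Abelem2 aT); rewrite inE => /andP[].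
  have -> : rank2_choice p (Abelem2 aT) = T by apply/group_inj/eqP;
    rewrite eqEcard sbE oT ob leqnn.
  by rewrite /tilde /section_relation solution1 => <-; rewrite subrK.
by exists (RatClass rat).
Qed.

(** Subtracting a constant makes the function vanish on the component of U. *)
Lemma normalised_representative (c : redH0p p P) U : exists phi,
  [/\ forall E : abelem2 p P, (p %| phi E)%Z, redH0_class phi = val c
    & U \in 'E_p^2(P) -> group_val phi U = 0].
Proof.
have /asboolP[phi dv ec] := redH0pP c.
have [pU|npU] := boolP (U \in 'E_p^2(P)); last by exists phi.
have [sUP abU _] := pnElemPcard pU.
have aU := abelem2_intro p_pr sUP abU (p2Elem_rank2 pU).
exists (phi - const_loc (phi (Abelem2 aU))); split.
- by move=> E; rewrite !ffunE rpredB ?dv.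
- by rewrite redH0_class_const -ec.
by move=> _; rewrite -[U]/(Abelem2 aU : {group gT}) group_valE !ffunE subrr.
Qed.

Section Realise.

Variables (Z U : {group gT}) (phi : locconst p P).
Hypotheses (piv : pivot p P Z U) (dv : forall E : abelem2 p P, (p %| phi E)%Z).
Hypothesis phiU : U \in 'E_p^2(P) -> group_val phi U = 0.

Let oZ : #|Z| = p. Proof. by have [[]] := piv. Qed.
Let sZZ : Z \subset 'Z(P). Proof. by have [[]] := piv. Qed.
Let sZP : Z \subset P. Proof. exact: subset_trans sZZ (center_sub P). Qed.
Let cZP : P \subset 'C(Z).
Proof. by rewrite centsC; apply: subset_trans sZZ (subsetIr _ _). Qed.

Lemma group_val_centralising D : D \in 'E_p^2(P) -> D \subset 'C(U) ->
  group_val phi D = 0.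
Proof.
move=> pD cDU; have [pU abG sGP DG UG] := p2Elem_centralising_pivot p_pr piv pD cDU.
by rewrite (group_val_sub p_pr _ sGP abG DG) -(group_val_sub p_pr _ sGP abG UG)
  phiU.
Qed.

(** Z is central, and a subgroup X of order p other than Z meets it
    trivially. *)
Lemma joinZ_p2Elem X : X \subset P -> #|X| = p -> X != Z ->
  (X <*> Z)%G \in 'E_p^2(P).
Proof.
move=> sXP oX neXZ; have cXZ := subset_trans sXP cZP.
have abXZ : p.-abelem (X <*> Z) by apply: abelem_joing; rewrite // ?prime_abelem.
apply: p2Elem_card; rewrite // ?join_subG ?sXP //= cent_joinEl // TI_cardMg ?oX
  ?oZ //.
apply: prime_TIg; rewrite ?oX //; apply: contra neXZ => sXZ.
by apply/eqP/group_inj/eqP; rewrite eqEcard sXZ oX oZ /=.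
Qed.

Fact realisation_superclass :
  [ffun X : {group gT} => if [&& #|X| == p, X \subset P & X != Z]
     then (group_val phi (X <*> Z)%G %/ p)%Z else 0] \in is_superclass P.
Proof.
apply/andP; split; apply/forallP=> X.
  by rewrite ffunE; case: (X \subset P); rewrite //= andbF eqxx.
apply/forall_inP=> g Pg; rewrite !ffunE cardJg /= -{1}(conjGid Pg) conjSg.
have eZ : (Z :^ g)%G = Z.
  by apply: group_inj; apply/normP/(subsetP (cents_norm cZP)).
have -> : ((X :^ g)%G == Z) = (X == Z).
  apply/eqP/eqP=> [eX|->//]; apply/group_inj/(@conjsg_inj _ g).
  by rewrite -[LHS]/(gval (X :^ g)%G) -[RHS]/(gval (Z :^ g)%G) eX eZ.
rewrite -(group_valJ phi (X <*> Z)%G Pg).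
have -> // : ((X <*> Z) :^ g)%G = ((X :^ g) <*> Z)%G.
by apply: group_inj; rewrite /= -{2}eZ conjYg.
Qed.

(** Only the subgroups X of order p other than Z carry values. If D = X Z,
    the p subgroups of order p of D other than Z all have the value phi D /
    p, so that the function attached to the realisation has the value phi D
    at D. *)
Definition realisation := SuperClass realisation_superclass.

Lemma realisation_off X : #|X| != p -> realisation X = 0.
Proof. by rewrite ffunE => /negPf->. Qed.

(** By orders, all terms of the relation of a section T / S with S
    nontrivial vanish, except perhaps f S with S of order p. If S
    centralises U then so does S Z, and phi (S Z) = 0. Otherwise T contains
    a group D of order p^2 that centralises U and commutes with S, so that S
    Z is in the component of D, where phi is also 0. *)
Lemma realisation_relations : nontrivial_relations p realisation.
Proof.
move=> S T ntS sTP sec; have p_gt1 := prime_gt1 p_pr; have p_gt0 := prime_gt0 p_pr.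
have S_gt1 : (1 < #|S|)%N by rewrite cardG_gt1.
have big (m : nat) : (1 < m)%N -> (p * m)%N != p.
  by move=> m1; rewrite neq_ltn -{3}[p]muln1 ltn_pmul2l // m1 orbT.
rewrite /section_relation big1 => [|X]; last first.
  rewrite inE => /andP[sSX sXT]; apply: realisation_off.
  by rewrite (psection_mid_card p_pr sec) // big.
rewrite [X in _ + _ * X]realisation_off ?mulr0 ?addr0; last first.
  by rewrite (psection_card sec) expnS expn1 -mulnA big // (leq_trans S_gt1) //
    leq_pmull.
rewrite ffunE; case: ifP => // /and3P[/eqP oS sSP neSZ].
have pSZ := joinZ_p2Elem sSP oS neSZ.
suff -> : group_val phi (S <*> Z)%G = 0 by rewrite div0z.
have sUP : U \subset P by have [_ []] := piv.
have [cST [cSU|[D pD [cDU sDT]]]] := section_centralising p_pr pP piv sTP oS sec.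
  apply: group_val_centralising => //; rewrite join_subG cSU /=.
  by rewrite centsC (subset_trans sUP).
have [sDP abD oD] := pnElemPcard pD; have [sSZ abSZ oSZ] := pnElemPcard pSZ.
have cDSZ : D \subset 'C(S <*> Z).
  by rewrite centY subsetI (subset_trans sDP cZP) andbT centsC (subset_trans cST)
    ?centS.
have abF : p.-abelem (D <*> (S <*> Z)) by apply: abelem_joing.
have sFP : D <*> (S <*> Z) \subset P by rewrite join_subG sDP.
rewrite (group_val_sub p_pr phi sFP abF (D := (S <*> Z)%G)).
  rewrite -(group_val_sub p_pr phi sFP abF (D := D));
    first exact: group_val_centralising.
  by rewrite inE joing_subl oD /=.
by rewrite inE joing_subr oSZ /=.
Qed.

Lemma tilde_realisation D : D \in 'E_p^2(P) -> Z \subset D ->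
  tilde p realisation D = group_val phi D.
Proof.
move=> pD sZD; have [sDP abD oD] := pnElemPcard pD.
have p_gt1 := prime_gt1 p_pr; have sec := p2Elem_psection pD.
have ZB : Z \in between 1%G D.
  rewrite inE proper1G -cardG_gt1 oZ p_gt1 // properEcard sZD oZ oD.
  by rewrite -{1}(expn1 p) ltn_exp2l.
rewrite /tilde [X in _ - _ * X]realisation_off ?mulr0 ?subr0; last first.
  by rewrite oD -{2}(expn1 p) eqn_exp2l.
rewrite (big_setD1 Z) //= [X in X + _]ffunE eqxx !andbF add0r.
rewrite (eq_bigr (fun=> (group_val phi D %/ p)%Z)) => [|X /setD1P[neXZ XB]].
  have := cardsD1 Z (between 1%G D);
    rewrite (card_between p_pr sec) ZB add1n => -[cB].
  have aD := abelem2_intro p_pr sDP abD (p2Elem_rank2 pD).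
  rewrite sumr_const -cB -mulr_natr natz divzK //.
  by rewrite -[D]/(Abelem2 aD : {group gT}) group_valE.
have [s1X sXD] : 1%G \proper X /\ X \proper D by move: XB; rewrite inE => /andP[].
have oX : #|X| = p by rewrite (psection_mid_card p_pr sec) // cards1 muln1.
have sXP := subset_trans (proper_sub sXD) sDP.
rewrite ffunE oX eqxx sXP neXZ /=; congr (group_val _ _ %/ _)%Z.
apply/group_inj/eqP; rewrite eqEcard join_subG (proper_sub sXD) sZD oD /=.
by have /pnElemPcard[_ _ ->] := joinZ_p2Elem sXP oX neXZ.
Qed.

End Realise.

(** Realise a representative that vanishes on the component of U. Both
    functions are locally constant, and every component contains a group of
    order p^2 that contains Z, where they agree. *)
Lemma obstruction_surj (c : redH0p p P) : exists s, obstruction s = c.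
Proof.
have [Z [U piv]] := pivot_exists p_pr pP rP.
have [phi [dv ec phiU]] := normalised_representative c U.
have rel := realisation_relations piv phiU.
have [s sf] := relations_gluing p_pr pP rel; exists s.
apply: val_inj; rewrite -ec /=; congr (redH0_class _).
apply/val_inj/ffunP=> E; rewrite [LHS](obstruction_tilde E sf).
have pD := rank2_choice_p2Elem p_pr E; have [sEP abE _] := abelem2_spec E.
have [D' [F [pD' sZD' [abF sFP] [DF D'F]]]] := p2Elem_with_center p_pr piv pD.
rewrite (tilde_const p_pr rel sFP abF DF D'F) tilde_realisation //.
rewrite (group_val_sub p_pr phi sFP abF D'F) -(group_val_sub p_pr phi sFP abF DF).
by rewrite (group_val_sub p_pr phi sEP abE (rank2_choiceP E)) group_valE.
Qed.

End ExactSequence.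

Local Close Scope ring_scope.

Theorem theorem4p4 (p : nat) (gT : finGroupType) (P : {group gT}) :
  prime p -> (p.-group P)%g -> (2 <= 'r(P))%g ->
  exists (r : {additive ratclass P -> gluing P})
         (d : {additive gluing P -> redH0p p P}),
    [/\ is_rmap r,
        is_dmap d,
        injective r,
        forall s : gluing P, d s = 0%R <-> exists f : ratclass P, s = r f
      & forall c : redH0p p P, exists s : gluing P, d s = c].
Proof.
move=> p_pr pP rP; have [r rmap rinj] := gluing_restriction p_pr pP rP.
pose dM := GRing.isZmodMorphism.Build _ _ (obstruction p_pr pP rP)
  (obstruction_zmod p_pr pP rP).
pose d : {additive gluing P -> redH0p p P} := HB.pack (obstruction p_pr pP rP) dM.
exists r, d; split=> // [s|s|c].
- exists (solution s 0), (tilde_locconst p_pr (solution_relations p_pr (solutionP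
  s 0))).
  by split=> //; [apply: solutionP | apply: tilde_locconstP].
- split=> [/obstruction_eq0[f sf]|[f ->]].
    by exists f; apply: (solution_inj sf).
  by apply/obstruction_eq0; exists f.
exact: obstruction_surj.
Qed.
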